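(* Let $a>-1$ and let $\mathcal E$ satisfy condition (E), with $d=\dim\mathcal E-1$. The function $|u|^a$ is integrable on $M$ for almost all $u\in\mathcal S$. Moreover, the function $u\mapsto\int_M|u(p)|^a\,dp$ belongs to $L^1(\mathcal S)$ and $$\mathsf M\left(\int_M|u(p)|^a\,dp\right)=\frac{\Gamma\left(\frac{a+1}2\right)\Gamma\left(\frac{d+1}2\right)(d+1)^{\frac a2}}{\sqrt\pi\;\Gamma\left(\frac{a+d+1}2\right)}.$$ If $a>2$ or $a\in(-1,0)$, then for all $d\in\mathbb N$ $$\mathsf M\left(\int_M|u(p)|^a\,dp\right)<2^{\frac a2}\frac{\Gamma\left(\frac{a+1}2\right)}{\sqrt\pi};$$ the reverse (strict) inequality holds for $a\in(0,2)$, and equality holds if $a=0$ or $a=2$.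
   Context: Functions are real-valued. $M$ is a compact connected Riemannian manifold; $G$ is a compact Lie group (possibly disconnected) acting on $M$ transitively by isometries, the action being virtually effective (its kernel is finite); $H$ is the stabilizer of a base point $o\in M$. $M=G/H$ is isotropy irreducible: $H$ has no proper nonzero invariant subspaces in $T_oM$. $dp$ is the $G$-invariant probability measure on $M$, and $L^2(M)$ is taken with respect to it. Condition (E) on $\mathcal E$: $\mathcal E$ is a nonzero finite dimensional $G$-invariant linear subspace of $L^2(M)$ orthogonal to the constant functions (its elements are real analytic functions, and $\dim\mathcal E>1$, so $d\ge1$). $\mathcal S$ is the unit sphere of $\mathcal E$ in the $L^2(M)$ norm, $du$ is the invariant probability measure on $\mathcal S$, and $\mathsf M(f)=\int_{\mathcal S}f(u)\,du$. *)

(* Defs.v *)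
From HB Require Import structures.
From mathcomp Require Import all_boot all_order all_algebra.
From mathcomp Require Import all_classical all_reals all_analysis measurable_realfun.

Set Implicit Arguments.
Unset Strict Implicit.
Unset Printing Implicit Defensive.
Import Order.TTheory GRing.Theory Num.Theory.
Import numFieldNormedType.Exports.

Local Open Scope classical_set_scope.
Local Open Scope ring_scope.

(* Vector space structure of L^2: all operations are those of representatives,
   up to almost everywhere equality. *)
Section L2_lmodule.
Context d (T : measurableType d) (R : realType).
Variable mu : {measure set T -> \bar R}.
Local Notation L2 := (LspaceType2 mu).
Local Notation LF2 := (LfunType mu (lee1n 2)).
Local Notation mf := ({mfun_ mu, T >-> measurableTypeR R}).

(* R and measurableTypeR R carry the same sigma-algebra under different
   displays; LspaceType is built on the latter and LfunType on the former. *)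
Definition mfun_measurableTypeR (f : {mfun T >-> R}) :
    {mfun T >-> measurableTypeR R} :=
  HB.pack (f : T -> measurableTypeR R)
    (@isMeasurableFun.Build _ _ T (measurableTypeR R) f (@measurable_funPT _ _ _ _ f)).

Lemma pi_ae (f : {mfun T >-> measurableTypeR R}) :
  {ae mu, forall x, (\pi_mf%qT f : mf) x = f x}.
Proof.
have /eqmodP : (repr (\pi_mf%qT f) = f %[mod mf])%qT by rewrite reprK.
by move=> /asboolP; apply: filterS => x /(_ I).
Qed.

Lemma eq_mf_ae (f g : mf) : {ae mu, forall x, f x = g x} -> f = g.
Proof.
move=> fg; rewrite -[f]reprK -[g]reprK; apply/eqmodP/asboolP.
by apply: filterS fg => x + _.
Qed.

Lemma L2_inj (u v : L2) : (u : mf) = v -> u = v.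
Proof.
case: u => u [[Hu]]; case: v => v [[Hv]] /= uv; subst v.
by rewrite (Prop_irrelevance Hu Hv).
Qed.

Lemma eq_L2_ae (u v : L2) : {ae mu, forall x, u x = v x} -> u = v.
Proof. by move=> uv; exact/L2_inj/eq_mf_ae. Qed.

Lemma measurable_L2 (u : L2) : measurable_fun [set: T] (u : T -> R).
Proof. exact: (@measurable_funPT _ _ _ _ (repr (u : mf))). Qed.


Lemma finite_norm_pi (f : LF2) :
  finite_norm mu 2%:E (\pi_mf%qT (mfun_measurableTypeR f) : mf).
Proof.
have := @Lfunction_finite _ _ _ _ _ _ f.
rewrite /finite_norm unlock /Lnorm => h; congr (_ < _)%E : h.
have mpow (g : T -> R) : measurable_fun setT g ->
    measurable_fun [set: T] ((fun x => `|(EFin \o g) x| `^ 2)%E : T -> \bar R).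
  move=> mg; apply/measurable_EFinP.
  apply: (measurableT_comp (measurable_powR 2)).
  exact: measurableT_comp.
congr (_ `^ _)%E; apply: ae_eq_integral => //.
- exact: mpow.
- by apply: mpow; exact: (@measurable_funPT _ _ _ _ (repr (_ : mf))).
- by apply: filterS (pi_ae (mfun_measurableTypeR f)) => x /= -> _.
Qed.

Definition L2_class (f : LF2) : L2 :=
  HB.pack (\pi_mf%qT (mfun_measurableTypeR f) : mf)
    (@isFinLebesgue.Build _ T R mu 2%:E (lee1n 2) _ (finite_norm_pi f)).

Lemma L2_classE (f : LF2) : {ae mu, forall x, L2_class f x = f x}.
Proof. exact: pi_ae. Qed.

Lemma L2_Lfun (u : L2) : (u : T -> R) \in Lfun mu 2%:E.
Proof.
apply/andP; split; rewrite inE; first exact: measurable_L2.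
exact: Lebesgue_finite.
Qed.

Definition L2_repr (u : L2) : LF2 := Lfun_Sub (lee1n 2) (L2_Lfun u).

HB.instance Definition _ := gen_eqMixin L2.
HB.instance Definition _ := gen_choiceMixin L2.

Definition L2_zero : L2 := L2_class 0.
Definition L2_opp (u : L2) : L2 := L2_class (- L2_repr u).
Definition L2_add (u v : L2) : L2 := L2_class (L2_repr u + L2_repr v).
Definition L2_scale (a : R) (u : L2) : L2 := L2_class (a *: L2_repr u).

Lemma L2_zeroE : {ae mu, forall x, L2_zero x = 0}.
Proof. exact: L2_classE. Qed.
Lemma L2_oppE u : {ae mu, forall x, L2_opp u x = - u x}.
Proof. exact: L2_classE. Qed.
Lemma L2_addE u v : {ae mu, forall x, L2_add u v x = u x + v x}.
Proof. exact: L2_classE. Qed.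
Lemma L2_scaleE a u : {ae mu, forall x, L2_scale a u x = a * u x}.
Proof. exact: L2_classE. Qed.

Lemma L2_addA : associative L2_add.
Proof.
move=> u v w; apply: eq_L2_ae.
apply: filterS3 (filterI (L2_addE u (L2_add v w)) (L2_addE (L2_add u v) w))
  (L2_addE u v) (L2_addE v w) => x [-> ->] -> ->.
by rewrite addrA.
Qed.

Lemma L2_addC : commutative L2_add.
Proof.
move=> u v; apply: eq_L2_ae.
by apply: filterS2 (L2_addE u v) (L2_addE v u) => x -> ->; rewrite addrC.
Qed.

Lemma L2_add0 : left_id L2_zero L2_add.
Proof.
move=> u; apply: eq_L2_ae.
by apply: filterS2 L2_zeroE (L2_addE L2_zero u) => x z ->; rewrite z add0r.
Qed.

Lemma L2_addN : left_inverse L2_zero L2_opp L2_add.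
Proof.
move=> u; apply: eq_L2_ae.
apply: filterS3 L2_zeroE (L2_oppE u) (L2_addE (L2_opp u) u) => x -> o ->.
by rewrite o addNr.
Qed.

HB.instance Definition _ :=
  GRing.isZmodule.Build L2 L2_addA L2_addC L2_add0 L2_addN.
HB.instance Definition _ := isPointed.Build L2 0.

Lemma L2_scaleA a b u : L2_scale a (L2_scale b u) = L2_scale (a * b) u.
Proof.
apply: eq_L2_ae.
apply: filterS3 (L2_scaleE b u) (L2_scaleE a (L2_scale b u))
  (L2_scaleE (a * b) u) => x h -> ->.
by rewrite h mulrA.
Qed.

Lemma L2_scale1 : left_id 1 L2_scale.
Proof.
move=> u; apply: eq_L2_ae.
by apply: filterS (L2_scaleE 1 u) => x ->; rewrite mul1r.
Qed.

Lemma L2_scaleDr : right_distributive L2_scale +%R.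
Proof.
move=> a u v; apply: eq_L2_ae.
apply: filterS3 (filterI (L2_scaleE a u) (L2_scaleE a v))
  (filterI (L2_scaleE a (L2_add u v)) (L2_addE u v))
  (L2_addE (L2_scale a u) (L2_scale a v)) => x [hu hv] [-> huv] ->.
by rewrite huv hu hv mulrDr.
Qed.

Lemma L2_scaleDl u : {morph L2_scale^~ u : a b / a + b}.
Proof.
move=> a b; apply: eq_L2_ae.
apply: filterS3 (filterI (L2_scaleE a u) (L2_scaleE b u))
  (L2_scaleE (a + b) u) (L2_addE (L2_scale a u) (L2_scale b u))
  => x [ha hb] -> ->.
by rewrite ha hb mulrDl.
Qed.

HB.instance Definition _ := GRing.Zmodule_isLmodule.Build R L2
  L2_scaleA L2_scale1 L2_scaleDr L2_scaleDl.

End L2_lmodule.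

Definition L2_norm d (T : measurableType d) (R : realType)
    (mu : {measure set T -> \bar R}) (u : LspaceType2 mu) : R :=
  fine ('N[mu]_2%:E[EFin \o u])%E.

Definition L2_dot d (T : measurableType d) (R : realType)
    (mu : {measure set T -> \bar R}) (f g : T -> R) : R :=
  (\int[mu]_x (f x * g x))%R.

Definition L2_open d (T : measurableType d) (R : realType)
    (mu : {measure set T -> \bar R}) : set (set (LspaceType2 mu)) :=
  [set U | forall u, U u ->
    exists2 r : R, 0 < r & forall v, L2_norm (v - u) < r -> U v].

(* L^2(mu) with the Borel sigma-algebra of its norm topology *)
Definition L2_borel d (T : measurableType d) (R : realType)
    (mu : {measure set T -> \bar R}) :=
  g_sigma_algebraType (@L2_open d T R mu).

Section linear_subspaces.
Context (R : realType) (V : lmodType R).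

Definition linear_subspace (E : set V) :=
  E 0 /\ forall (a : R) u v, E u -> E v -> E (a *: u + v).

Definition has_dim (E : set V) (k : nat) := exists e : 'I_k -> V,
  (forall c : 'I_k -> R, \sum_i c i *: e i = 0 -> forall i, c i = 0) /\
  E = [set \sum_i c i *: e i | c in [set: 'I_k -> R]].

End linear_subspaces.

Section smooth_functions.
Context (R : realType).

(* f is of class C^k on the open set U of the finite dimensional space V *)
Fixpoint C_class (k : nat) (V W : normedModType R) (U : set V) (f : V -> W)
    : Prop :=
  if k is k'.+1 then
    (forall x, U x -> differentiable f x) /\
    forall v, C_class k' U (fun x => 'd f x v)
  else forall x, U x -> {for x, continuous f}.

Definition smooth_on (V W : normedModType R) (U : set V) (f : V -> W) :=
  forall k, C_class k U f.

End smooth_functions.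

Section smooth_manifolds.
Context (R : realType).

Record chart (n : nat) (M : topologicalType) := Chart {
  chart_dom : set M;
  chart_map :> M -> 'rV[R]_n;
  chart_inv : 'rV[R]_n -> M;
  chart_dom_open : open chart_dom;
  chart_img_open : open (chart_map @` chart_dom);
  chart_mapK : forall x, chart_dom x -> chart_inv (chart_map x) = x;
  chart_map_continuous :
    forall x, chart_dom x -> {for x, continuous chart_map};
  chart_inv_continuous :
    forall y, (chart_map @` chart_dom) y -> {for y, continuous chart_inv} }.

Record smooth_manifold (n : nat) (M : topologicalType) := SmoothManifold {
  charts : set (chart n M);
  manifold_hausdorff : hausdorff_space M;
  manifold_second_countable : @second_countable M;
  charts_cover : forall x : M, exists2 c, charts c & chart_dom c x;
  charts_compatible : forall c1 c2, charts c1 -> charts c2 ->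
    smooth_on (c1 @` (chart_dom c1 `&` chart_dom c2)) (c2 \o chart_inv c1) }.

Definition in_charts m n (M N : topologicalType) (c1 : chart m M)
    (c2 : chart n N) (f : M -> N) : 'rV[R]_m -> 'rV[R]_n :=
  c2 \o f \o chart_inv c1.

Definition smooth_map m n (M N : topologicalType) (sM : smooth_manifold m M)
    (sN : smooth_manifold n N) (f : M -> N) :=
  continuous f /\
  forall c1 c2, charts sM c1 -> charts sN c2 ->
    smooth_on (c1 @` (chart_dom c1 `&` f @^-1` chart_dom c2))
      (in_charts c1 c2 f).

(* smoothness of a map from the product manifold M x N, in product charts *)
Definition smooth_map2 l m n (L M N : topologicalType)
    (sL : smooth_manifold l L) (sM : smooth_manifold m M)
    (sN : smooth_manifold n N) (f : L -> M -> N) :=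
  continuous (fun z : L * M => f z.1 z.2) /\
  forall c1 c2 c3, charts sL c1 -> charts sM c2 -> charts sN c3 ->
    smooth_on
      [set (c1 z.1, c2 z.2) | z in [set z : L * M |
         [/\ chart_dom c1 z.1, chart_dom c2 z.2 & chart_dom c3 (f z.1 z.2)]]]
      (fun w : 'rV[R]_l * 'rV[R]_m =>
         c3 (f (chart_inv c1 w.1) (chart_inv c2 w.2))).

Definition bilin n (A : 'M[R]_n) (v w : 'rV[R]_n) : R :=
  (v *m A *m w^T) ord0 ord0.

(* g c x is the Gram matrix of the inner product of the tangent space at the
   point with coordinates x in the chart c. *)
Definition preserves_metric n (M : topologicalType) (sM : smooth_manifold n M)
    (g : chart n M -> 'rV[R]_n -> 'M[R]_n) (f : M -> M) :=
  forall c1 c2, charts sM c1 -> charts sM c2 ->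
  forall x, chart_dom c1 x -> chart_dom c2 (f x) ->
  forall v w : 'rV[R]_n,
    bilin (g c2 (c2 (f x))) ('d (in_charts c1 c2 f) (c1 x) v)
                            ('d (in_charts c1 c2 f) (c1 x) w) =
    bilin (g c1 (c1 x)) v w.

Record riemannian_metric n (M : topologicalType) (sM : smooth_manifold n M) :=
  RiemannianMetric {
  gram :> chart n M -> 'rV[R]_n -> 'M[R]_n;
  gram_smooth : forall c, charts sM c -> smooth_on (c @` chart_dom c) (gram c);
  gram_sym : forall c x, charts sM c -> chart_dom c x ->
    (gram c (c x))^T = gram c (c x);
  gram_posdef : forall c x, charts sM c -> chart_dom c x ->
    forall v : 'rV[R]_n, v != 0 -> 0 < bilin (gram c (c x)) v v;
  gram_tensor : preserves_metric sM gram id }.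

End smooth_manifolds.

#[short(type="topGroupType")]
HB.structure Definition TopGroup := {G of Group G & Topological G}.

Record lie_group (R : realType) (m : nat) (G : topGroupType) := LieGroup {
  lie_manifold :> smooth_manifold R m G;
  lie_mul_smooth : smooth_map2 lie_manifold lie_manifold lie_manifold
    (fun x y : G => (x * y)%g);
  lie_inv_smooth : smooth_map lie_manifold lie_manifold
    (fun x : G => (x^-1)%g) }.

Section homogeneous_spaces.
Context (R : realType) (m n : nat) (G : topGroupType) (M : ptopologicalType).
Implicit Types (sG : lie_group R m G) (sM : smooth_manifold R n M).
Implicit Types (act : G -> M -> M) (o : M).

Definition is_action act := (forall x, act 1%g x = x) /\
  forall g h x, act (g * h)%g x = act g (act h x).

Definition transitive_action act := forall x y, exists g, act g x = y.

Definition stabilizer act o : set G := [set h | act h o = o].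

Definition kernel act : set G := [set g | forall x, act g x = x].

(* The tangent space at o is identified with R^n by a chart c at o; an element
   h of the stabilizer then acts on it by the differential of h in c. *)
Definition isotropy_irreducible sM act o :=
  forall c, charts sM c -> chart_dom c o ->
  forall W : {vspace 'rV[R]_n},
    (forall h, stabilizer act o h -> forall v, v \in W ->
       'd (in_charts c c (act h)) (c o) v \in W) ->
    W = 0%VS \/ W = fullv.

Record homogeneous_irreducible sG sM (g : riemannian_metric sM) act o :=
  HomogeneousIrreducible {
  M_compact : compact [set: M];
  M_connected : connected [set: M];
  G_compact : compact [set: G];
  act_action : is_action act;
  act_smooth : smooth_map2 sG sM sM act;
  act_transitive : transitive_action act;
  act_isometric : forall x, preserves_metric sM g (act x);
  act_virtually_effective : finite_set (kernel act);
  act_irreducible : isotropy_irreducible sM act o }.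

Definition borel_type := g_sigma_algebraType (@open M).

Definition invariant_measure act (P : probability borel_type R) :=
  forall g (A : set borel_type), measurable A -> P (act g @^-1` A) = P A.

End homogeneous_spaces.

Section random_elements.
Context (R : realType) (G : topGroupType) (M : ptopologicalType).
Variables (act : G -> M -> M) (P : probability (borel_type M) R).
Local Notation L2 := (LspaceType2 P).

Record condition_E (E : set L2) := ConditionE {
  E_subspace : linear_subspace E;
  E_findim : exists k, has_dim E k;
  E_nonzero : exists2 u, E u & u != 0;
  (* the class of u \o act g belongs to E *)
  E_invariant : forall g u, E u ->
    exists2 v, E v & {ae P, forall x, v x = u (act g x)};
  E_orthogonal : forall u (c : R), E u -> L2_dot P u (cst c) = 0 }.

Definition unit_sphere (E : set L2) : set L2 :=
  [set u | E u /\ L2_norm u = 1].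

(* Only the restriction of U to E matters. *)
Definition linear_isometry (E : set L2) (U : L2 -> L2) :=
  [/\ forall u, E u -> E (U u),
      forall (a : R) u v, E u -> E v -> U (a *: u + v) = a *: U u + U v
    & forall u, E u -> L2_norm (U u) = L2_norm u].

(* The O(E)-invariant probability measure of the unit sphere of E, as a Borel
   probability on L^2 that is concentrated on the sphere. *)
Definition sphere_measure (E : set L2) (sigma : probability (L2_borel P) R) :=
  sigma (unit_sphere E) = 1%E /\
  forall U, linear_isometry E U -> forall A : set (L2_borel P), measurable A ->
    sigma (unit_sphere E `&` U @^-1` A) = sigma A.

End random_elements.

Section mean_value.
Context (R : realType).

(* |x|^a, with value +oo at x = 0 when a < 0 (whereas 0 `^ a = 0) *)
Definition abs_pow (a x : R) : \bar R :=
  if (a < 0) && (x == 0) then +oo%E else (`|x| `^ a)%:E.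

Definition Gamma (x : R) : R :=
  (\int[lebesgue_measure]_(t in `]0%R, +oo[) (t `^ (x - 1) * expR (- t)))%R.

End mean_value.

(* Main.v *)
From HB Require Import structures.
Require Import Defs.
From mathcomp Require Import all_boot all_order all_algebra.
From mathcomp Require Import all_classical all_reals all_analysis measurable_realfun.
From mathcomp Require Import ring lra.
Import Order.TTheory GRing.Theory Num.Theory.
Import numFieldNormedType.Exports.
Local Open Scope classical_set_scope.
Local Open Scope ring_scope.

(** Let e_0, ..., e_d be an orthonormal basis of E. On E the evaluation
    u |-> u(p) is the inner product with w_p = sum_i e_i(p) e_i, and the
    squared norm of w_p is K(p) = sum_i e_i(p)^2. The uniform measure of the
    sphere is invariant under the reflection that exchanges w_p and |w_p| e_0,
    so <u, w_p> has the same law as |w_p| <u, e_0> (sphere_dot_norm), and the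
    mean of |u(p)|^a over the sphere is K(p)^(a/2) I_a, where I_a is the a-th
    absolute moment of one coordinate on the sphere. The group acts on E by
    orthogonal transformations, so K is invariant (kernel_diag_invariant);
    therefore it is constant, equal to its mean d + 1. By Tonelli the mean
    value of the theorem is (d + 1)^(a/2) I_a.

    An element of E is a class of functions, so K is invariant under each
    group element only outside a null set, and constancy is an ergodicity
    statement (invariant_const). It is proved without a Haar measure. Let A be
    invariant up to null sets and let a closed set F lie in an open set U. As
    the group is compact, there is an invariant neighbourhood V of the
    diagonal with V(F) contained in U. All sections of V have the same
    measure, and so have their intersections with A; counting the V-close
    pairs in U x A in two ways gives P(A /\ F) <= P(A) P(U). It follows that
    A is independent of every open set, then of every Borel set, hence of
    itself: P(A) is 0 or 1.

    The moment I_a is classically read off from polar coordinates of a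
    Gaussian vector X in R^(d+1). Here it comes from evaluating one integral
    over (X, u) in two orders (sphere_moment_gauss): integrating |<u, X>|^a in
    u first leaves |X|^a I_a, integrating in X first leaves a one-dimensional
    Gaussian moment. The integrals of powers of |X| that remain are found by
    writing the power as a mixture of exponentials (laplace_mixture), which
    leaves Gaussian integrals of varying width and the beta integral. On the
    sphere of dimension 0 the same identity gives the one-dimensional Gaussian
    moments, and Gamma(1/2) as well.

    For the inequalities put x = (d + 1)/2 and s = a/2. The mean value is the
    bound times x^s Gamma(x) / Gamma(x + s) (mean_value_factor). Since
    Gamma(x + s) / Gamma(x) is the mean of t^s for the Gamma law of parameter
    x, whose mean is x, this factor is compared with 1 by strict Jensen:
    Gamma_gt when t^s is strictly convex, Gamma_lt when it is strictly
    concave. For s = 1 the factor is 1 by the functional equation. *)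

(** * Gaussian integrals in several variables *)

(** Gaussian integrals in n + 1 variables are built by induction on n, so the
    product measure has to be again a factor in Tonelli's theorem: it is
    needed as a sigma-finite measure, not only as a set function. *)
Lemma sigma_finite_prod (R : realType) d1 d2 (T1 : measurableType d1)
    (T2 : measurableType d2) (m1 : {sigma_finite_measure set T1 -> \bar R})
    (m2 : {sigma_finite_measure set T2 -> \bar R}) :
  exists m : {sigma_finite_measure set (T1 * T2)%type -> \bar R},
    m = (m1 \x m2)%E :> (set (T1 * T2) -> \bar R).
Proof.
have sf : sigma_finite setT (m1 \x m2)%E.
  have /sigma_finiteP[F [TF ndF Foo]] := sigma_finiteT m1.
  have /sigma_finiteP[G [TG ndG Goo]] := sigma_finiteT m2.
  exists (fun n => F n `*` G n) => [|k].
    apply/seteqP; split => // -[x y] _.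
    have [i _ Fx] : (\bigcup_n F n) x by rewrite -TF.
    have [j _ Gy] : (\bigcup_n G n) y by rewrite -TG.
    exists (maxn i j) => //; split => /=.
      by move: Fx; apply/subsetPset/ndF/leq_maxl.
    by move: Gy; apply/subsetPset/ndG/leq_maxr.
  have [mF F_oo] := Foo k; have [mG G_oo] := Goo k.
  split; first exact: measurableX.
  by rewrite product_measure1E// lte_mul_pinfty// ge0_fin_numE.
pose m : {sigma_finite_measure set (T1 * T2)%type -> \bar R} :=
  HB.pack (m1 \x m2)%E (Measure_isSigmaFinite.Build _ _ _ (m1 \x m2)%E sf).
by exists m.
Qed.

Section gauss.
Context {R : realType}.
Local Notation mu := (@lebesgue_measure R).
Local Open Scope ereal_scope.
Implicit Types (f : R -> \bar R).

(** Lebesgue measure is the image of its own multiple by |k| under the affine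
    map, because the two measures agree on half-open intervals. *)
Lemma ge0_integral_affine f (k m : R) : k != 0%R ->
  measurable_fun [set: R] f -> (forall x, 0 <= f x) ->
  \int[mu]_x f (k * x + m)%R = `|k|^-1%:E * \int[mu]_x f x.
Proof.
move=> k0 mf f0.
pose phi : measurableTypeR R -> measurableTypeR R := fun x => (k * x + m)%R.
have mphi : measurable_fun setT phi.
  by apply: measurable_funD => //; apply: measurable_funM.
pose nu0 : {measure set (measurableTypeR R) -> \bar R} := mscale (NngNum (normr_ge0 k)) (pushforward mu phi).
pose nu := nu0 mphi.
have E : forall A, measurable A -> mu A = nu A.
  apply: lebesgue_measure_unique => _ [[a b]] /= _ <-.
  rewrite /nu /nu0 /mscale /= /pushforward.
  have [kp|kn|kz] := ltgtP k 0%R; last by rewrite kz eqxx in k0.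
  - have -> : phi @^-1` `]a, b]%classic = `[((b - m) / k)%R, ((a - m) / k)%R[%classic.
      apply/seteqP; split=> x /=; rewrite !in_itv /= /phi.
        by move=> /andP[h1 h2]; rewrite ler_ndivrMr// ltr_ndivlMr//; lra.
      by rewrite ler_ndivrMr// ltr_ndivlMr// => /andP[h1 h2]; lra.
    rewrite !lebesgue_measure_itv/= !lte_fin ltr_nM2r ?invr_lt0//.
    rewrite ltrD2r; case: ifPn => _; last by rewrite mule0.
    rewrite -!EFinB -EFinM ltr0_norm//; congr (_%:E).
    by field.
  - have -> : phi @^-1` `]a, b]%classic = `]((a - m) / k)%R, ((b - m) / k)%R]%classic.
      apply/seteqP; split=> x /=; rewrite !in_itv /= /phi.
        by move=> /andP[h1 h2]; rewrite ltr_pdivrMr// ler_pdivlMr//; lra.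
      by rewrite ltr_pdivrMr// ler_pdivlMr// => /andP[h1 h2]; lra.
    rewrite !lebesgue_measure_itv/= !lte_fin ltr_pM2r ?invr_gt0//.
    rewrite ltrD2r; case: ifPn => _; last by rewrite mule0.
    rewrite -!EFinB -EFinM gtr0_norm//; congr (_%:E).
    by field.
have -> : \int[mu]_x f x = \int[nu]_x f x by apply: eq_measure_integral => A mA _; exact: E.
rewrite ge0_integral_mscale//= ge0_integral_pushforward//.
by rewrite muleA -EFinM mulVf ?normr_eq0// mul1e preimage_setT.
Qed.

Definition gauss_weight (x : R) : R := expR (- (x ^+ 2 / 2)).

Lemma gauss_weight_ge0 x : (0 <= gauss_weight x)%R. Proof. exact: expR_ge0. Qed.
Lemma measurable_gauss_weight : measurable_fun [set: R] gauss_weight.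
Proof.
by apply: measurableT_comp => //; apply: measurableT_comp => //; apply: measurable_funM.
Qed.

Lemma integral_gauss_weight : \int[mu]_x (gauss_weight x)%:E = (Num.sqrt (2 * pi))%:E.
Proof.
have := integral_normal_pdf (0:R) 1.
rewrite normal_pdfE ?oner_eq0//.
under eq_integral do rewrite EFinM.
rewrite ge0_integralZl//; first last.
- by rewrite lee_fin normal_peak_ge0.
- by move=> x _; rewrite lee_fin normal_fun_ge0.
- by apply/measurable_EFinP; exact: measurable_normal_fun.
under eq_integral => x _.
  have -> : normal_fun 0 1 x = gauss_weight x.
    by rewrite /normal_fun /gauss_weight; congr expR; rewrite expr1n; field.
  over.
rewrite /normal_peak => h.
have p0 : (0 < Num.sqrt ((1:R) ^+ 2 * pi *+ 2))%R.
  by rewrite sqrtr_gt0 expr1n mul1r mulrn_wgt0// pi_gt0.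
have <- : Num.sqrt ((1:R) ^+ 2 * pi *+ 2) = Num.sqrt (2 * pi) :> R.
  by rewrite expr1n mul1r mulr_natl.
transitivity ((Num.sqrt ((1:R) ^+ 2 * pi *+ 2))%:E * ((Num.sqrt ((1:R) ^+ 2 * pi *+ 2))^-1%:E * \int[mu]_x (gauss_weight x)%:E)).
  by rewrite muleA -EFinM divff ?gt_eqF// mul1e.
by rewrite h mule1.
Qed.

Lemma gauss_norm_scale f (k : R) : measurable_fun [set: R] f -> (forall x, 0 <= f x) ->
  \int[mu]_x (f (k * x)%R * (gauss_weight x)%:E) = \int[mu]_x (f (`|k| * x)%R * (gauss_weight x)%:E).
Proof.
move=> mf f0; have [k0|k0] := leP 0%R k; first by rewrite ger0_norm.
have h := @ge0_integral_affine (fun x => f (k * x)%R * (gauss_weight x)%:E) (-1) 0.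
have {h} := h; rewrite oppr_eq0 oner_eq0 normrN normr1 invr1 mul1e => <- //.
- apply: eq_integral => x _; rewrite ltr0_norm//; congr (f _ * (_)%:E); first by ring.
  by rewrite /gauss_weight; congr expR; ring.
- apply: emeasurable_funM; last by apply/measurable_EFinP; exact: measurable_gauss_weight.
  by apply: measurableT_comp => //; apply: measurable_funM.
- by move=> x; rewrite mule_ge0// lee_fin gauss_weight_ge0.
Qed.

(** Rotation invariance of the Gaussian weight of the plane, with the total
    mass of one direction already split off. The substitution v = c y + s z,
    where (c, s) is (p, q) normalised, turns the argument of f into r v;
    completing the square then leaves a shifted one-dimensional Gaussian in z. *)
Lemma gauss_comb f (p q : R) : measurable_fun [set: R] f -> (forall x, 0 <= f x) ->
  \int[mu]_z \int[mu]_y (f (p * y + q * z)%R * (gauss_weight y * gauss_weight z)%:E) =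
  (Num.sqrt (2 * pi))%:E *
    \int[mu]_x (f (Num.sqrt (p ^+ 2 + q ^+ 2) * x)%R * (gauss_weight x)%:E).
Proof.
move=> mf f0.
have mfa (k m : R) : measurable_fun [set: R] (fun x => f (k * x + m)%R).
  by apply: measurableT_comp => //; apply: measurable_funD => //; apply: measurable_funM.
have mgE : measurable_fun [set: R] (EFin \o gauss_weight) by apply/measurable_EFinP; exact: measurable_gauss_weight.
have [->|p0] := eqVneq p 0%R.
  rewrite expr0n add0r sqrtr_sqr -gauss_norm_scale//.
  under eq_integral => z _.
    under eq_integral => y _ do rewrite mul0r add0r EFinM muleA muleAC.
    rewrite ge0_integralZl//; first over.
    - by move=> x _; rewrite lee_fin gauss_weight_ge0.
    - by rewrite mule_ge0// lee_fin gauss_weight_ge0.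
  rewrite ge0_integralZr//.
  - by rewrite integral_gauss_weight muleC.
  - apply: emeasurable_funM => //.
    by have := mfa q 0%R; under eq_fun do rewrite addr0.
  - by move=> x _; rewrite mule_ge0// lee_fin gauss_weight_ge0.
  - by apply: integral_ge0 => x _; rewrite lee_fin gauss_weight_ge0.
set r := Num.sqrt (p ^+ 2 + _)%R.
have pq0 : (0 < p ^+ 2 + q ^+ 2)%R.
  by rewrite ltr_wpDr ?sqr_ge0// exprn_even_gt0.
have r0 : (0 < r)%R by rewrite sqrtr_gt0.
have r2 : (r ^+ 2 = p ^+ 2 + q ^+ 2)%R by rewrite sqr_sqrtr// ltW.
pose c := (p / r)%R; pose s := (q / r)%R.
have c0 : c != 0%R by rewrite mulf_neq0 ?invr_eq0 ?(gt_eqF r0).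
have cs : (c ^+ 2 + s ^+ 2 = 1)%R.
  by rewrite !exprMn -mulrDl -r2 exprVn divff// gt_eqF// exprn_gt0.
pose g v := f (r * v)%R.
have mg : measurable_fun [set: R] g.
  by have := mfa r 0%R; under eq_fun do rewrite addr0.
have g0 v : 0 <= g v by exact: f0.
have E1 z : \int[mu]_y (f (p * y + q * z)%R * (gauss_weight y * gauss_weight z)%:E) =
    `|c|^-1%:E * \int[mu]_v (g v * (gauss_weight ((v - s * z) / c) * gauss_weight z)%:E).
  (* The substitution v = c y + s z in the inner integral. *)
  have := @ge0_integral_affine
    (fun v => g v * (gauss_weight ((v - s * z) / c) * gauss_weight z)%:E) c (s * z) c0.
  move=> <-.
  - apply: eq_integral => y _; rewrite /g.
    congr (f _ * (gauss_weight _ * _)%:E).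
      by rewrite /c /s; field; rewrite gt_eqF.
    by field.
  - apply: emeasurable_funM => //; apply/measurable_EFinP/measurable_funM => //.
    apply: measurableT_comp => //; first exact: measurable_gauss_weight.
    by apply: measurable_funM => //; apply: measurable_funD.
  - by move=> x; rewrite mule_ge0// lee_fin mulr_ge0// gauss_weight_ge0.
under eq_integral do rewrite E1.
pose H (zv : measurableTypeR R * measurableTypeR R) :=
  g zv.2 * (gauss_weight ((zv.2 - s * zv.1) / c) * gauss_weight zv.1)%:E.
have mH : measurable_fun setT H.
  apply: emeasurable_funM; first by apply: measurableT_comp => //.
  apply/measurable_EFinP/measurable_funM => //.
    apply: measurableT_comp => //; first exact: measurable_gauss_weight.
    apply: measurable_funM => //; apply: measurable_funD => //.
    by apply: measurableT_comp => //; apply: measurable_funM.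
  by apply: measurableT_comp => //; exact: measurable_gauss_weight.
have H0 zv : 0 <= H zv by rewrite mule_ge0// lee_fin mulr_ge0// gauss_weight_ge0.
rewrite ge0_integralZl//; first last.
- by move=> z _; apply: integral_ge0 => y _; exact: (H0 (z, y)).
- exact: (measurable_fun_fubini_tonelli_F _ mH).
rewrite (@fubini_tonelli _ _ _ _ _ mu mu H mH H0).
rewrite -ge0_integralZl//; first last.
- by move=> z _; apply: integral_ge0 => y _; exact: (H0 (y, z)).
- exact: (measurable_fun_fubini_tonelli_G _ mH).
rewrite -ge0_integralZl//; first last.
- by move=> z _; rewrite mule_ge0// lee_fin gauss_weight_ge0.
- by apply: emeasurable_funM.
apply: eq_integral => v _; rewrite /H /=.
(* Completing the square; the exponents agree because c^2 + s^2 = 1. *)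
have E2 z : g v * (gauss_weight ((v - s * z) / c) * gauss_weight z)%:E =
    (g v * (gauss_weight v)%:E) * (gauss_weight (c^-1 * z + - (s * v) / c))%:E.
  rewrite -muleA; congr (_ * _); rewrite -EFinM; congr (_%:E).
  rewrite /gauss_weight -!expRD; congr expR.
  have -> : (c^-1 * z + - (s * v) / c = (z - s * v) / c)%R by rewrite mulrBl mulrC mulNr.
  have s2 : (s ^+ 2 = 1 - c ^+ 2)%R by rewrite -cs addrC addKr.
  have : (((v - s * z) ^+ 2 + c ^+ 2 * z ^+ 2) = c ^+ 2 * v ^+ 2 + (z - s * v) ^+ 2)%R.
    transitivity (v ^+ 2 + z ^+ 2 - 2 * s * v * z)%R; last first.
      by transitivity (c ^+ 2 * v ^+ 2 + z ^+ 2 + s ^+ 2 * v ^+ 2 - 2 * s * v * z)%R; [rewrite s2|]; ring.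
    by transitivity (c ^+ 2 * z ^+ 2 + v ^+ 2 + s ^+ 2 * z ^+ 2 - 2 * s * v * z)%R; [|rewrite s2]; ring.
  move=> h.
  have c2 : (c ^+ 2 != 0)%R by rewrite sqrf_eq0.
  apply: (mulfI c2); apply/eqP; rewrite -subr_eq0; apply/eqP.
  transitivity ((- ((v - s * z) ^+ 2 + c ^+ 2 * z ^+ 2) + (c ^+ 2 * v ^+ 2 + (z - s * v) ^+ 2)) / 2)%R.
    by field.
  by rewrite h addNr mul0r.
under eq_integral do rewrite E2.
rewrite ge0_integralZl//; first last.
- by rewrite mule_ge0// lee_fin gauss_weight_ge0.
- by move=> z _; rewrite lee_fin gauss_weight_ge0.
- apply: (measurableT_comp mgE).
  by apply: measurable_funD => //; apply: measurable_funM.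
rewrite (@ge0_integral_affine (EFin \o gauss_weight) c^-1)//; first last.
- by move=> z; rewrite lee_fin gauss_weight_ge0.
- by rewrite invr_eq0.
by rewrite normfV invrK integral_gauss_weight muleCA -!EFinM mulKf ?normr_eq0// muleC.
Qed.

(** This is all that is used about Lebesgue measure on R^(n+1): under a
    centred Gaussian weight a linear form is a one-dimensional Gaussian
    variable. The space is kept abstract, and the parameter r makes Gaussian
    weights of all widths available on the same space, which is what the
    Laplace transforms below need. *)
Lemma gauss_space (n : nat) :
  exists (d : measure_display) (T : measurableType d)
    (m : {sigma_finite_measure set T -> \bar R}) (X : nat -> T -> R),
  (forall i, measurable_fun [set: T] (X i)) /\
  forall (u : nat -> R) (r : R) f, (0 < r)%R ->
    measurable_fun [set: R] f -> (forall x, 0 <= f x) ->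
    \int[m]_t (f (\sum_(i < n.+1) u i * X i t)%R *
               (expR (- (r ^+ 2 * (\sum_(i < n.+1) X i t ^+ 2) / 2)))%:E) =
    (Num.sqrt (2 * pi) ^+ n * r ^- n.+1)%:E *
      \int[mu]_x (f (Num.sqrt (\sum_(i < n.+1) u i ^+ 2) / r * x)%R * (gauss_weight x)%:E).
Proof.
elim: n => [|n [d [T [m [X [mX IH]]]]]].
  exists _, (measurableTypeR R), mu, (fun _ x => x); split; first by move=> i; exact: measurable_id.
  move=> u r f r0 mf f0.
  under eq_integral do rewrite !big_ord1.
  have := @ge0_integral_affine (fun y => f (u 0%N / r * y)%R * (gauss_weight y)%:E) r 0.
  rewrite gt_eqF// gtr0_norm// expr1 expr0 mul1r gauss_norm_scale// big_ord1 sqrtr_sqr.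
  rewrite normrM normfV (gtr0_norm r0) => <- //.
  - apply: eq_integral => x _; congr (f _ * (_)%:E); first by rewrite addr0; field; rewrite gt_eqF.
    by rewrite /gauss_weight; congr expR; ring.
  - apply: emeasurable_funM; last by apply/measurable_EFinP; exact: measurable_gauss_weight.
    by apply: measurableT_comp => //; apply: measurable_funM.
  - by move=> x; rewrite mule_ge0// lee_fin gauss_weight_ge0.
have [mm mmE] := @sigma_finite_prod _ _ _ _ _ m mu.
exists _, (T * measurableTypeR R)%type, mm.
pose X' i (z : T * measurableTypeR R) : R := if (i <= n)%N then X i z.1 else z.2.
exists X'; split.
  move=> i; rewrite /X'; case: (i <= n)%N; last exact: measurable_snd.
  by apply: measurableT_comp => //.
move=> u r f r0 mf f0.
pose A (t : T) := (\sum_(i < n.+1) u i * X i t)%R.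
pose S (t : T) := (\sum_(i < n.+1) X i t ^+ 2)%R.
have mA : measurable_fun setT A.
  by apply: measurable_sum => i; apply: measurable_funM.
have mS : measurable_fun setT S.
  by apply: measurable_sum => i; apply: measurable_funX.
pose e (x : R) : R := expR (- (r ^+ 2 * x / 2)).
have me : measurable_fun [set: R] e.
  apply: measurableT_comp => //; apply: measurableT_comp => //.
  by apply: measurable_funM => //; apply: measurable_funM.
pose H (z : T * measurableTypeR R) := f (A z.1 + u n.+1 * z.2)%R * (e (S z.1) * e (z.2 ^+ 2))%:E.
have mH : measurable_fun setT H.
  apply: emeasurable_funM.
    apply: measurableT_comp => //; apply: measurable_funD.
      exact: measurableT_comp.
    by apply: measurable_funM.
  apply/measurable_EFinP/measurable_funM; apply: measurableT_comp => //.
    exact: measurableT_comp.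
  by apply: measurable_funX.
have H0 z : 0 <= H z by rewrite mule_ge0// lee_fin mulr_ge0// expR_ge0.
transitivity (\int[m \x mu]_z H z).
  rewrite -mmE.
  apply: eq_integral => z _; rewrite 2!(big_ord_recr n.+1)/= /H /X' /= ltnn.
  congr (f (_ + _)%R * (_)%:E).
  - by rewrite /S; apply: eq_bigr => i _; rewrite -ltnS ltn_ord.
  - rewrite /e -expRD; congr expR.
    have -> : (\sum_(i < n.+1) (if (i <= n)%N then X i z.1 else z.2) ^+ 2 = S z.1)%R.
      by apply: eq_bigr => i _; rewrite -ltnS ltn_ord.
    by ring.
rewrite (fubini_tonelli2 _ mH H0) /fubini_G.
pose p := (Num.sqrt (\sum_(i < n.+1) u i ^+ 2) / r)%R.
pose q := (u n.+1 / r)%R.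
pose C := (Num.sqrt (2 * pi) ^+ n * r ^- n.+1)%R : R.
have C0 : (0 <= C)%R by rewrite mulr_ge0// ?exprn_ge0// ?sqrtr_ge0// invr_ge0 exprn_ge0// ltW.
have E1 (x : R) : \int[m]_t H (t, x) =
    C%:E * \int[mu]_y (f (p * y + q * (r * x))%R * (gauss_weight y * gauss_weight (r * x))%:E).
  rewrite /H /=.
  have mfx : measurable_fun [set: R] (fun v => f (v + u n.+1 * x)%R).
    by apply: measurableT_comp => //; apply: measurable_funD.
  have := IH u r (fun v => f (v + u n.+1 * x)%R) r0 mfx (fun v => f0 _).
  rewrite -/C => IHx.
  under eq_integral do rewrite EFinM muleA.
  rewrite ge0_integralZr//; first last.
  - by rewrite lee_fin expR_ge0.
  - by move=> t _; rewrite mule_ge0// lee_fin expR_ge0.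
  - apply: emeasurable_funM; first exact: (measurableT_comp mfx).
    by apply/measurable_EFinP; exact: measurableT_comp.
  rewrite IHx -muleA -ge0_integralZr//; first last.
  - by rewrite lee_fin expR_ge0.
  - by move=> y _; rewrite mule_ge0// lee_fin expR_ge0.
  - apply: emeasurable_funM; last by apply/measurable_EFinP; exact: measurable_gauss_weight.
    by apply: (measurableT_comp mfx); apply: measurable_funM.
  congr (_ * _); apply: eq_integral => y _.
  rewrite -muleA -EFinM; congr (f _ * (_ * _)%:E).
    by rewrite /p /q; field; rewrite gt_eqF.
  by rewrite /e /gauss_weight; congr expR; ring.
under eq_integral do rewrite E1.
pose F (zy : measurableTypeR R * measurableTypeR R) :=
  f (p * zy.2 + q * zy.1)%R * (gauss_weight zy.2 * gauss_weight zy.1)%:E.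
have mF : measurable_fun setT F.
  apply: emeasurable_funM.
    by apply: measurableT_comp => //; apply: measurable_funD; apply: measurable_funM.
  by apply/measurable_EFinP/measurable_funM; apply: measurableT_comp => //; exact: measurable_gauss_weight.
have F0 z : 0 <= F z by rewrite mule_ge0// lee_fin mulr_ge0// gauss_weight_ge0.
pose h (z : R) := C%:E * \int[mu]_y F (z, y).
have mh : measurable_fun [set: R] h.
  apply: measurable_funeM; exact: (measurable_fun_fubini_tonelli_F _ mF).
have h0 z : 0 <= h z.
  by rewrite mule_ge0//; apply: integral_ge0 => y _.
transitivity (\int[mu]_x h (r * x + 0)%R).
  by apply: eq_integral => x _; rewrite addr0.
rewrite ge0_integral_affine ?gt_eqF// gtr0_norm// ge0_integralZl//; first last.
- by move=> z _; apply: integral_ge0 => y _.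
- exact: (measurable_fun_fubini_tonelli_F _ mF).
have -> := gauss_comb f p q mf f0.
rewrite !muleA -!EFinM; congr (_%:E * _).
  by rewrite /C (exprS (Num.sqrt _) n) (exprS r n.+1) invfM; ring.
apply: eq_integral => x _; congr (f (_ * _)%R * _).
have -> : (p ^+ 2 + q ^+ 2 = (\sum_(i < n.+2) u i ^+ 2) / r ^+ 2)%R.
  rewrite big_ord_recr/= /p /q !exprMn sqr_sqrtr; last by apply: sumr_ge0 => i _; exact: sqr_ge0.
  by rewrite mulrDl exprVn.
rewrite sqrtrM; last by apply: sumr_ge0 => i _; exact: sqr_ge0.
by rewrite sqrtrV ?sqrtr_sqr ?gtr0_norm// sqr_ge0.
Qed.

End gauss.

(** * The Gamma function *)

Section gamma.
Context {R : realType}.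
Local Notation mu := (@lebesgue_measure R).
Local Open Scope ereal_scope.

(** Extending t^(b-1) by 0 turns integrals over the half-line into integrals
    over R, where the affine change of variables applies. *)
Definition mellin_power (b t : R) : R := if (0 < t)%R then (t `^ (b - 1))%R else 0%R.

Lemma mellin_power_ge0 b t : (0 <= mellin_power b t)%R.
Proof. by rewrite /mellin_power; case: ifP => // _; exact: powR_ge0. Qed.

Lemma measurable_mellin_power b : measurable_fun [set: R] (mellin_power b).
Proof.
apply: (@measurable_fun_ifT _ _ _ _ (fun t : R => t `^ (b - 1))%R (fun=> 0%R)
  (fun t : R => 0 < t)%R) => //.
exact: measurable_fun_ltr.
Qed.

Lemma integral_mellin_power b (g : R -> R) :
  \int[mu]_(t in `]0%R, +oo[) (t `^ (b - 1) * g t)%:E = \int[mu]_t (mellin_power b t * g t)%:E.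
Proof.
rewrite integral_mkcond; apply: eq_integral => t _.
rewrite patchE mem_setE in_itv/= andbT /mellin_power.
by case: ifP => // _; rewrite mul0r.
Qed.

(** The value of Gamma in the extended reals: Tonelli's theorem applies to it
    before finiteness is known. *)
Definition GammaE (x : R) := \int[mu]_(t in `]0%R, +oo[) (t `^ (x - 1) * expR (- t))%:E.

Lemma GammaE_ge0 x : 0 <= GammaE x.
Proof. by apply: integral_ge0 => t _; rewrite lee_fin mulr_ge0 ?powR_ge0 ?expR_ge0. Qed.

Lemma GammaE_mellin x : GammaE x = \int[mu]_t (mellin_power x t * expR (- t))%:E.
Proof. exact: integral_mellin_power. Qed.

Lemma measurable_expRN (c : R) : measurable_fun [set: R] (fun t : R => expR (- (c * t))).
Proof. by apply: measurableT_comp => //; apply: measurableT_comp => //; apply: measurable_funM. Qed.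

(** Read from right to left, this writes a negative power as a mixture of
    exponentials; the radial integrals are reduced to Gaussian ones in this
    way. *)
Lemma laplace_power b (c : R) : (0 < c)%R ->
  \int[mu]_t (mellin_power b t * expR (- (c * t)))%:E = (c `^ (- b))%:E * GammaE b.
Proof.
move=> c0.
have h := @ge0_integral_affine R (fun t => (mellin_power b t * expR (- t))%:E) c 0 (lt0r_neq0 c0).
have /h {}h : measurable_fun [set: R] (fun t => (mellin_power b t * expR (- t))%:E).
  apply/measurable_EFinP; apply: measurable_funM; first exact: measurable_mellin_power.
  by apply: measurableT_comp => //; apply: measurableT_comp.
rewrite GammaE_mellin.
have : (c `^ (b - 1))%:E * \int[mu]_t (mellin_power b t * expR (- (c * t)))%:E = c^-1%:E * \int[mu]_t (mellin_power b t * expR (- t))%:E.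
  have {}h := h (fun x => mulr_ge0 (mellin_power_ge0 b x) (expR_ge0 _)).
  have -> : c^-1%:E = `|c|^-1%:E :> \bar R by rewrite gtr0_norm.
  rewrite -h -ge0_integralZl//.
  - apply: eq_integral => t _; rewrite -EFinM; congr (_%:E).
    rewrite addr0 mulrA; congr (_ * _)%R.
    rewrite /mellin_power pmulr_rgt0//; case: ifPn => [t0|_]; last by rewrite mulr0.
    by rewrite powRM// ltW.
  - by apply/measurable_EFinP; apply: measurable_funM; [exact: measurable_mellin_power|exact: measurable_expRN].
  - by move=> t _; rewrite lee_fin mulr_ge0 ?mellin_power_ge0 ?expR_ge0.
  - by rewrite lee_fin powR_ge0.
move=> /(congr1 (fun z => (c `^ (1 - b))%:E * z)).
rewrite !muleA -!EFinM -powRD; last by rewrite (gt_eqF c0) implybT.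
rewrite (_ : 1 - b + (b - 1) = 0)%R; last by ring.
rewrite powRr0 mul1e => ->; congr (_%:E * _).
by rewrite -[X in (_ * X)%R](powR_inv1 (ltW c0)) -powRD ?(gt_eqF c0) ?implybT//; congr (_ `^ _)%R; ring.
Qed.

Lemma powR_expE (x s : R) : (0 < x)%R -> (x `^ s = expR (s * ln x))%R.
Proof. by move=> x0; rewrite /powR gt_eqF. Qed.

(** Both sides are the integral of t^(b-1) s^(c-1) exp(-(1 + t) s) over the
    quadrant, computed in the two orders. *)
Lemma betaE b c :
  GammaE c * \int[mu]_t (mellin_power b t * (1 + t) `^ (- c))%:E = GammaE b * GammaE (c - b).
Proof.
pose H (ts : measurableTypeR R * measurableTypeR R) :=
  (mellin_power b ts.1 * (mellin_power c ts.2 * expR (- ((1 + ts.1) * ts.2))))%:E.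
have H0 z : 0 <= H z by rewrite lee_fin !mulr_ge0 ?mellin_power_ge0 ?expR_ge0.
have mH : measurable_fun setT H.
  apply/measurable_EFinP; apply: measurable_funM.
    by apply: measurableT_comp => //; exact: measurable_mellin_power.
  apply: measurable_funM; first by apply: measurableT_comp => //; exact: measurable_mellin_power.
  apply: measurableT_comp => //; apply: measurableT_comp => //.
  by apply: measurable_funM => //; apply: measurable_funD.
have mexp (k : R) : measurable_fun [set: R] (fun s => (mellin_power c s * expR (- (k * s)))%:E).
  by apply/measurable_EFinP; apply: measurable_funM; [exact: measurable_mellin_power|exact: measurable_expRN].
transitivity (\int[mu]_t \int[mu]_s H (t, s)).
  rewrite -ge0_integralZl ?GammaE_ge0//; last first.
  - by move=> t _; rewrite lee_fin mulr_ge0 ?mellin_power_ge0 ?powR_ge0.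
  - apply/measurable_EFinP; apply: measurable_funM; first exact: measurable_mellin_power.
    apply: (measurableT_comp (measurable_powR (- c))) => //.
    by apply: measurable_funD.
  apply: eq_integral => t _; rewrite /H/=.
  under eq_integral do rewrite EFinM.
  rewrite ge0_integralZl//; first last.
  - by rewrite lee_fin mellin_power_ge0.
  - by move=> s _; rewrite lee_fin mulr_ge0 ?mellin_power_ge0 ?expR_ge0.
  - exact: mexp.
  have [t0|t0] := ltP 0%R t; last by rewrite /mellin_power ltNge t0/= !mul0r mul0e mule0.
  rewrite laplace_power; last by rewrite addr_gt0.
  by rewrite muleA -EFinM muleC.
rewrite (fubini_tonelli _ mH H0).
transitivity (\int[mu]_s (GammaE b * (mellin_power (c - b) s * expR (- s))%:E)).
  apply: eq_integral => s _; rewrite /H/=.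
  have [s0|s0] := ltP 0%R s; last first.
    have pws k : mellin_power k s = 0%R by rewrite /mellin_power ltNge s0.
    rewrite !pws mul0r mule0.
    by apply: integral0_eq => t _; rewrite mul0r mulr0.
  have E t : (mellin_power b t * (mellin_power c s * expR (- ((1 + t) * s))))%:E =
      (mellin_power c s * expR (- s))%:E * (mellin_power b t * expR (- (s * t)))%:E.
    rewrite -EFinM; congr (_%:E).
    by rewrite mulrDl mul1r opprD expRD [(t * s)%R]mulrC; ring.
  under eq_integral do rewrite E.
  rewrite ge0_integralZl//; first last.
  - by rewrite lee_fin mulr_ge0 ?mellin_power_ge0 ?expR_ge0.
  - by move=> t _; rewrite lee_fin mulr_ge0 ?mellin_power_ge0 ?expR_ge0.
  - by apply/measurable_EFinP; apply: measurable_funM; [exact: measurable_mellin_power|exact: measurable_expRN].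
  rewrite laplace_power// muleA muleC -EFinM; congr (_ * _%:E).
  rewrite mulrAC; congr (_ * _)%R; rewrite /mellin_power s0 -powRD ?(gt_eqF s0) ?implybT//.
  by congr (_ `^ _)%R; ring.
rewrite ge0_integralZl//.
- by rewrite -GammaE_mellin.
- by have := mexp 1%R; under eq_fun do rewrite mul1r; move=> _;
  apply/measurable_EFinP; apply: measurable_funM; [exact: measurable_mellin_power|];
  apply: measurableT_comp => //; apply: measurableT_comp.
- by move=> t _; rewrite lee_fin mulr_ge0 ?mellin_power_ge0 ?expR_ge0.
- exact: GammaE_ge0.
Qed.

Lemma GammaE1 : GammaE 1 = 1.
Proof.
rewrite /GammaE; under eq_integral do rewrite subrr powRr0 mul1r.
rewrite integral_itv_obnd_cbnd; last first.
  apply/measurable_EFinP; apply: measurable_funTS.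
  by apply: measurableT_comp => //; apply: measurableT_comp.
rewrite (@ge0_continuous_FTC2y R _ (fun x => - expR (- x))%R 0 0).
- by rewrite oppr0 expR0 sub0e EFinN oppeK.
- by move=> x _; exact: expR_ge0.
- apply: continuous_subspaceT => x; apply: continuous_comp; last exact: continuous_expR.
  exact: (@continuousN _ R^o).
- rewrite -oppr0; apply: (@cvgN _ R^o); exact: cvgr_expR.
- move=> x _; exact: ex_derive.
- apply: cvg_at_right_filter; apply: (@cvgN _ R^o).
  by apply: continuous_comp; [exact: (@continuousN _ R^o)|exact: continuous_expR].
- by move=> x _; rewrite derive1E derive_val mulrN1 opprK.
Qed.

(** The beta integral with an elementary primitive. Through betaE it yields
    the functional equation of Gamma. *)
Lemma beta1 (c : R) : (1 < c)%R ->
  \int[mu]_t (mellin_power 1 t * (1 + t) `^ (- c))%:E = (c - 1)^-1%:E.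
Proof.
move=> c1; rewrite -integral_mellin_power.
under eq_integral do rewrite subrr powRr0 mul1r.
have m : measurable_fun setT (fun x : R => ((1 + x) `^ (- c))%R).
  by apply: (measurableT_comp (measurable_powR (- c))) => //; apply: measurable_funD.
rewrite integral_itv_obnd_cbnd; last by apply/measurable_EFinP; apply: measurable_funTS.
have D (a x : R) : (- 1 < x)%R -> is_derive x (1%R:R) (fun x : R => (1 + x) `^ a)%R (a * (1 + x) `^ (a - 1))%R.
  move=> x0.
  have h : is_derive (1 + x)%R (1%R:R) (@powR R ^~ a) (a * (1 + x) `^ (a - 1))%R.
    by apply: is_derive1_powR; lra.
  have := @is_derive1_comp R (@powR R ^~ a) (fun x : R => 1 + x)%R x _ 1%R h.
  rewrite mulr1; apply.
  by apply: is_derive_eq; rewrite add0r mulr1.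
have C (a x : R) : (- 1 < x)%R -> {for x, continuous (fun x : R => (1 + x) `^ a)%R}.
  move=> x0; have [h _] := D a x x0.
  by apply: differentiable_continuous; exact/derivable1_diffP.
have DF (x : R) : (- 1 < x)%R ->
    is_derive x (1%R:R) (fun x : R => - ((c - 1)^-1 * (1 + x) `^ (1 - c)))%R ((1 + x) `^ (- c))%R.
  move=> x0; have h := D (1 - c)%R x x0.
  have := @is_deriveN _ _ _ _ _ _ _ (@is_deriveZ _ _ _ _ (c - 1)^-1%R _ _ _ h).
  move=> /is_derive_eq; apply.
  rewrite /GRing.scale/= mulrA -mulNr -mulrN opprB mulVf ?subr_eq0 ?gt_eqF// mul1r.
  by congr (_ `^ _)%R; ring.
rewrite (@ge0_continuous_FTC2y R _ (fun x => - ((c - 1)^-1 * (1 + x) `^ (1 - c)))%R 0 0).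
- by rewrite addr0 powR1 mulr1 sub0e EFinN oppeK.
- by move=> x _; exact: powR_ge0.
- apply/continuous_within_itvcyP; split.
    by move=> x; rewrite in_itv/= andbT => x0; apply: C; lra.
  by apply: cvg_at_right_filter; apply: C; lra.
- rewrite -oppr0; apply: (@cvgN _ R^o); rewrite -(mulr0 ((c - 1)^-1)%R).
  apply: (@cvgMl_tmp R).
  apply/cvgrPdist_lt => e e0; near=> x.
  have x0 : (0 < x)%R by near: x; exact: nbhs_pinfty_gt.
  rewrite sub0r normrN ger0_norm ?powR_ge0// -(opprB c 1) powRN.
  rewrite -[ltRHS]invrK ltf_pV2 ?posrE ?invr_gt0 ?powR_gt0//; last lra.
  have -> : (e^-1 = (e `^ (- (c - 1)^-1)) `^ (c - 1))%R.
    by rewrite -powRrM mulNr mulVf ?powR_inv1// ?ltW// subr_eq0 gt_eqF.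
  apply: gt0_ltr_powR; rewrite ?subr_gt0// ?nnegrE ?powR_ge0//; first lra.
  suff : (e `^ (- (c - 1)^-1) < x)%R by lra.
  by near: x; exact: nbhs_pinfty_gt.
- by move=> x x0; have [] := DF x ltac:(lra).
- apply: cvg_at_right_filter; apply: (@cvgN _ R^o); apply: (@cvgMl_tmp R).
  by apply: C; lra.
- move=> x; rewrite in_itv/= andbT => x0.
  have h := DF x ltac:(lra).
  by rewrite derive1E derive_val.
Unshelve. all: by end_near. Qed.

End gamma.

Section gamma2.
Context {R : realType}.
Local Notation mu := (@lebesgue_measure R).
Local Open Scope ereal_scope.

Lemma GammaES (x : R) : (0 < x)%R -> GammaE (x + 1) = x%:E * GammaE x.
Proof.
move=> x0; have := betaE 1%R (x + 1)%R; rewrite beta1; last lra.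
rewrite GammaE1 mul1e !addrK => <-.
by rewrite muleCA -EFinM divff ?gt_eqF// mule1.
Qed.

Lemma measurable_Gamma_integrand (x : R) : measurable_fun [set: R] (fun t => t `^ (x - 1) * expR (- t))%R.
Proof.
apply: measurable_funM; first exact: (measurable_powR (x - 1)).
by apply: measurableT_comp => //; apply: measurableT_comp.
Qed.

(** On [1, 2] the integrand is at most the sum of those for 1 and 2, and the
    functional equation carries finiteness to the other arguments. *)
Lemma GammaE_lty (x : R) : (0 < x)%R -> GammaE x < +oo.
Proof.
move=> x0.
have b (y : R) : (1 <= y <= 2)%R -> GammaE y < +oo.
  move=> /andP[y1 y2].
  have G2 : GammaE 2 = 1 :> \bar R.
    by have := GammaES _ ltr01; rewrite GammaE1 mule1 => <-; congr GammaE; ring.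
  apply: (@le_lt_trans _ _ (GammaE 1 + GammaE 2)); last first.
    by rewrite GammaE1 G2 ltry.
  rewrite /GammaE -ge0_integralD//.
  - apply: ge0_le_integral => //.
    + by move=> t _; rewrite lee_fin mulr_ge0 ?powR_ge0 ?expR_ge0.
    + by apply/measurable_EFinP/measurable_funTS; exact: measurable_Gamma_integrand.
    + apply/measurable_funTS/emeasurable_funD; apply/measurable_EFinP; exact: measurable_Gamma_integrand.
    + move=> t /=; rewrite in_itv/= andbT => t0.
      rewrite -EFinD lee_fin -mulrDl ler_pM2r ?expR_gt0//.
      rewrite subrr powRr0 (_ : 2 - 1 = 1)%R; last by ring.
      rewrite powRr1 ?ltW//.
      have [t1|t1] := leP 1%R t.
        have y11 : (y - 1 <= 1)%R by lra.
        by have := ler_powR t1 y11; rewrite powRr1 ?(ltW t0)//; lra.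
      have y10 : (0 <= y - 1)%R by lra.
      have t01 : (0 < t <= 1)%R by rewrite t0 ltW.
      by have := ger_powR t01 y10; rewrite powRr0; lra.
  - by move=> t _; rewrite lee_fin mulr_ge0 ?powR_ge0 ?expR_ge0.
  - by apply/measurable_EFinP/measurable_funTS; exact: measurable_Gamma_integrand.
  - by move=> t _; rewrite lee_fin mulr_ge0 ?powR_ge0 ?expR_ge0.
  - by apply/measurable_EFinP/measurable_funTS; exact: measurable_Gamma_integrand.
suff h n : forall y : R, (0 < y <= n.+2%:R)%R -> GammaE y < +oo.
  apply: (h (Num.truncn x)); rewrite x0/=.
  by have := truncnS_gt x; rewrite -(natr1 (Num.truncn x).+1); lra.
elim: n => [|n IH] y /andP[y0 yn].
  have [y1|y1] := leP 1%R y; first by apply: b; rewrite y1.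
  have : GammaE (y + 1) < +oo by apply: b; lra.
  rewrite GammaES// => h.
  by rewrite ltNge leye_eq; apply/negP => /eqP E; rewrite E gt0_muley ?lte_fin in h.
have [y2|y2] := leP y 2%:R; first by apply: IH; rewrite y0 (le_trans y2)// ler_nat.
have : GammaE (y - 1) < +oo.
  by apply: IH; move: yn; rewrite -natr1; lra.
have -> : y = (y - 1 + 1)%R by ring.
rewrite GammaES; last lra.
by rewrite addrK => h; rewrite lte_mul_pinfty// lee_fin; lra.
Qed.

Lemma GammaE_fin (x : R) : (0 < x)%R -> GammaE x = (Gamma x)%:E.
Proof. by move=> x0; rewrite fineK// ge0_fin_numE ?GammaE_ge0// GammaE_lty. Qed.

(** The excepted point x is there for the difference between t^s and its
    tangent at x. *)
Lemma integral_pos_gt0 (f : R -> R) (x : R) : measurable_fun [set: R] f ->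
  (forall t : R, (0 < t)%R -> (0 <= f t)%R) -> (forall t : R, (0 < t)%R -> t != x -> f t != 0%R) ->
  0 < \int[mu]_(t in `]0%R, +oo[) (f t)%:E.
Proof.
move=> mf f0 fx.
have D0 (t : R) : `]0%R, +oo[%classic t -> (0 < t)%R by rewrite /= in_itv/= andbT.
rewrite lt0e; apply/andP; split; last first.
  by apply: integral_ge0 => t /D0 t0; rewrite lee_fin f0.
apply/negP => /eqP I0.
have mE : measurable_fun (`]0%R, +oo[%classic : set R) (EFin \o f).
  by apply/measurable_funTS/measurable_EFinP.
have : \int[mu]_(t in `]0%R, +oo[) `|(EFin \o f) t| = 0.
  rewrite -{}I0; apply: eq_integral => t; rewrite inE => /D0 t0.
  by rewrite gee0_abs// lee_fin f0.
move/(ae_eq_integral_abs mu (measurable_itv _) mE) => [N [mN N0 sN]].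
have : mu (`]0%R, 1%R[%classic : set R) <= mu (N `|` [set x]).
  apply: le_measure; rewrite ?inE//; first exact: measurableU.
  move=> t /=; rewrite in_itv/= => /andP[t0 _].
  have [->|tx] := eqVneq t x; first by right.
  left; apply: sN => /= /(_ _)/wrap[]; first by rewrite in_itv/= t0.
  by move=> [/eqP]; apply/negP; exact: fx.
rewrite lebesgue_measure_itv/= lte_fin ltr01 oppr0 adde0.
suff -> : mu (N `|` [set x]) = 0 by rewrite leNgt lte_fin ltr01.
apply/eqP; rewrite eq_le measure_ge0 andbT.
apply: (@le_trans _ _ (mu N + mu [set x])); first exact: measureU2.
by rewrite [mu N]N0 lebesgue_measure_set1 adde0.
Qed.

Lemma Gamma_gt0 (x : R) : (0 < x)%R -> (0 < Gamma x)%R.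
Proof.
move=> x0; rewrite -lte_fin -GammaE_fin//; apply: (@integral_pos_gt0 _ 0%R).
- exact: measurable_Gamma_integrand.
- by move=> t t0; rewrite mulr_ge0 ?powR_ge0 ?expR_ge0.
- by move=> t t0 _; rewrite mulf_neq0 ?gt_eqF ?powR_gt0 ?expR_gt0.
Qed.

Lemma GammaS (x : R) : (0 < x)%R -> (Gamma (x + 1) = x * Gamma x)%R.
Proof.
move=> x0; apply/EFin_inj; rewrite EFinM -!GammaE_fin ?GammaES//; lra.
Qed.

Lemma Gamma1 : Gamma 1 = 1%R :> R.
Proof. by apply/EFin_inj; rewrite -GammaE_fin ?GammaE1. Qed.

Local Open Scope ring_scope.

(** Let A be the right-hand side. The bound ln y <= y - 1 at y = u/A (where it
    is strict) and at y = 1/A, with the weights s and 1 - s, gives s ln u - ln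
    A < 0, because the weighted sum of the values y - 1 vanishes. *)
Lemma powR_lt_tangent (u s : R) : 0 < u -> u != 1 -> 0 < s < 1 ->
  u `^ s < 1 + s * (u - 1).
Proof.
move=> u0 u1 /andP[s0 s1].
set A := 1 + s * (u - 1).
have A0 : 0 < A by rewrite /A; nra.
have lnlt (y : R) : 0 < y -> ln y <= y - 1 /\ (y != 1 -> ln y < y - 1).
  move=> y0; split.
    by have := expR_ge1Dx (ln y); rewrite lnK ?posrE//; lra.
  move=> y1; have : ln y != 0 by rewrite ln_eq0.
  by move/expR_gt1Dx; rewrite lnK ?posrE//; lra.
have uA : u / A != 1.
  apply/negP => /eqP /(congr1 (fun z => z * A)).
  rewrite divfK ?gt_eqF// mul1r /A => h.
  by move/eqP: u1; apply; nra.
have [_ /(_ uA) h1] := lnlt (u / A) (divr_gt0 u0 A0).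
have [h2 _] := lnlt (1 / A) (divr_gt0 ltr01 A0).
rewrite !ln_div ?posrE// ln1 in h1 h2.
rewrite powR_expE// -[ltRHS]lnK ?posrE// ltr_expR.
have : s * (u / A - 1) + (1 - s) * (1 / A - 1) = 0.
  by rewrite /A; field; rewrite -/A gt_eqF.
nra.
Qed.

(** For s > 1 this is the concave case for the exponent 1/s at the point u^s;
    for s < 0 it follows from exp z >= 1 + z and ln u < u - 1. *)
Lemma powR_gt_tangent (u s : R) : 0 < u -> u != 1 -> 1 < s \/ s < 0 ->
  1 + s * (u - 1) < u `^ s.
Proof.
move=> u0 u1 [s1|s0].
  have v1 : u `^ s != 1 by rewrite powR_eq1 negb_or u1/= negb_or -leNgt ltW//= gt_eqF//; lra.
  have := @powR_lt_tangent (u `^ s) s^-1 (powR_gt0 _ u0) v1.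
  rewrite -powRrM mulfV ?gt_eqF//; last lra.
  rewrite powRr1 ?ltW// invr_gt0 invf_lt1; try lra.
  have s0 : 0 < s by lra.
  move=> /(_ ltac:(lra)); rewrite -ltrBlDl ltr_pdivlMl// => ?; lra.
have lu : ln u != 0 by rewrite ln_eq0.
have lnu : ln u < u - 1 by move/expR_gt1Dx: lu; rewrite lnK ?posrE//; lra.
rewrite powR_expE//; have := expR_ge1Dx (s * ln u); nra.
Qed.

End gamma2.

(* Keeps unification from unfolding Gamma into an integral. *)
Local Opaque Gamma.

(** * Strict Jensen inequalities for the Gamma function *)

Section gamma_jensen.
Context {R : realType}.
Local Notation mu := (@lebesgue_measure R).

Lemma Gamma_integrable (x : R) : 0 < x ->
  mu.-integrable `]0%R, +oo[ (EFin \o (fun t : R => t `^ (x - 1) * expR (- t))).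
Proof.
move=> x0; apply/integrableP; split.
  by apply/measurable_funTS/measurable_EFinP; exact: measurable_Gamma_integrand.
under eq_integral => t _ do rewrite /= ger0_norm ?mulr_ge0 ?powR_ge0 ?expR_ge0//.
exact: GammaE_lty.
Qed.

(** Strict Jensen inequality for the Gamma law of parameter x, whose mean is
    x: the tangent of t^s at t = x integrates to x^s Gamma(x). The factor c is
    the sign that distinguishes convex from concave exponents. *)
Lemma Gamma_tangent (c x s : R) : 0 < x -> 0 < x + s ->
  (forall u, 0 < u -> u != 1 -> 0 < c * (u `^ s - (1 + s * (u - 1)))) ->
  0 < c * (Gamma (x + s) - x `^ s * Gamma x).
Proof.
move=> x0 xs0 H.
pose g (y t : R) := t `^ (y - 1) * expR (- t).
(* The tangent of t^s at t = x is A + B t. *)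
pose A := x `^ s * (1 - s); pose B := s * x `^ s / x.
pose f t := c * (g (x + s) t - A * g x t - B * g (x + 1) t).
have ig y : 0 < y -> mu.-integrable `]0%R, +oo[ (EFin \o g y).
  exact: Gamma_integrable.
have fE t : 0 < t -> f t = x `^ s * (c * ((t / x) `^ s - (1 + s * (t / x - 1)))) * g x t.
  move=> t0; rewrite /f /g /A /B addrK.
  have -> : t `^ (x + s - 1) = t `^ s * t `^ (x - 1).
    by rewrite -powRD ?(gt_eqF t0) ?implybT//; congr (_ `^ _); ring.
  have -> : t `^ x = t * t `^ (x - 1) by rewrite mulr_powRB1// ltW.
  have -> : t `^ s = x `^ s * (t / x) `^ s.
    by rewrite -powRM ?divr_ge0 ?(ltW t0) ?(ltW x0)// mulrCA divff ?gt_eqF// mulr1.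
  by field; rewrite gt_eqF.
have f_gt t : 0 < t -> t != x -> 0 < f t.
  move=> t0 tx; rewrite fE// mulr_gt0//; last by rewrite mulr_gt0 ?powR_gt0 ?expR_gt0.
  rewrite mulr_gt0 ?powR_gt0//; apply: H; first exact: divr_gt0.
  by apply: contra tx => /eqP h; rewrite -[t](divfK (lt0r_neq0 x0)) h mul1r.
have iZ k h : mu.-integrable `]0%R, +oo[ (EFin \o h) ->
    mu.-integrable `]0%R, +oo[ (EFin \o (fun t => k * h t)).
  move=> ih; rewrite (_ : _ \o _ = (fun t => k%:E * (h t)%:E)%E)//.
  by apply: integrableZl.
have iB h k : mu.-integrable `]0%R, +oo[ (EFin \o h) ->
    mu.-integrable `]0%R, +oo[ (EFin \o k) ->
    mu.-integrable `]0%R, +oo[ (EFin \o (fun t => h t - k t)).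
  move=> ih ik; rewrite (_ : _ \o _ = ((EFin \o h) \- (EFin \o k))%E)//.
  by apply: integrableB.
have x10 : 0 < x + 1 by lra.
have i1 := iB _ _ (ig _ xs0) (iZ A _ (ig _ x0)).
have i2 := iB _ _ i1 (iZ B _ (ig _ x10)).
have : 0 < \int[mu]_(t in `]0%R, +oo[) f t.
  rewrite /Rintegral fine_gt0//; apply/andP; split; last first.
    by apply: integrable_lty => //; exact: iZ i2.
  apply: (@integral_pos_gt0 _ _ x).
  - apply: measurable_funM => //; apply: measurable_funB.
      apply: measurable_funB; first exact: measurable_Gamma_integrand.
      by apply: measurable_funM => //; exact: measurable_Gamma_integrand.
    by apply: measurable_funM => //; exact: measurable_Gamma_integrand.
  - move=> t t0; have [->|tx] := eqVneq t x; last by rewrite ltW// f_gt.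
    by rewrite fE// divff ?gt_eqF// subrr mulr0 addr0 powR1 subrr !mulr0 mul0r.
  - by move=> t t0 tx; rewrite gt_eqF// f_gt.
rewrite RintegralZl// RintegralB//; last exact: iZ (ig _ x10).
rewrite RintegralB//; [|exact: ig|exact: iZ (ig _ x0)].
rewrite !RintegralZl//; [|exact: ig|exact: ig].
rewrite -[X in X - _ - _]/(Gamma (x + s)) -[X in _ - A * X - _]/(Gamma x) -[X in _ - B * X]/(Gamma (x + 1)).
rewrite GammaS// => h; congr (_ < _ * _): h.
by rewrite /A /B; field; rewrite gt_eqF.
Qed.

Lemma Gamma_gt (x s : R) : 0 < x -> 0 < x + s -> 1 < s \/ s < 0 ->
  x `^ s * Gamma x < Gamma (x + s).
Proof.
move=> x0 xs0 hs; rewrite -subr_gt0 -[ltRHS]mul1r; apply: Gamma_tangent => // u u0 u1.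
by rewrite mul1r subr_gt0 powR_gt_tangent.
Qed.

Lemma Gamma_lt (x s : R) : 0 < x -> 0 < x + s -> 0 < s < 1 ->
  Gamma (x + s) < x `^ s * Gamma x.
Proof.
move=> x0 xs0 hs; rewrite -subr_gt0 -opprB -mulN1r; apply: Gamma_tangent => // u u0 u1.
by rewrite mulN1r opprB subr_gt0 powR_lt_tangent.
Qed.

End gamma_jensen.

(** With x = (k + 1)/2 and s = a/2, the mean value is split into its bound and
    the factor x^s Gamma(x) / Gamma(x + s), which Gamma_gt and Gamma_lt
    compare with 1. *)
Lemma mean_value_factor {R : realType} (a k c p : R) : 0 < k + 1 ->
  c * Gamma ((k + 1) / 2) * (k + 1) `^ (a / 2) / (p * Gamma ((a + k + 1) / 2)) =
  2 `^ (a / 2) * (c / p) *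
  (((k + 1) / 2) `^ (a / 2) * Gamma ((k + 1) / 2) / Gamma ((k + 1) / 2 + a / 2)).
Proof.
move=> k0.
have -> : (a + k + 1) / 2 = (k + 1) / 2 + a / 2 by ring.
have -> : (k + 1) `^ (a / 2) = 2 `^ (a / 2) * ((k + 1) / 2) `^ (a / 2).
  by rewrite -powRM ?divr_ge0 ?(ltW k0)// (mulrC 2) divfK.
rewrite invfM.
move: (Gamma _) (Gamma _) (_ `^ _) (_ `^ _) => g1 g2 p1 p2.
move: (p^-1) (g2^-1) => p' g'; ring.
Qed.

(** * Moments of a coordinate on the sphere *)

Section sphere_moments.
Context {R : realType}.
Local Notation mu := (@lebesgue_measure R).
Local Open Scope ereal_scope.

Lemma abs_pow_ge0 (a x : R) : 0 <= abs_pow a x.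
Proof. by rewrite /abs_pow; case: ifP => // _; rewrite lee_fin powR_ge0. Qed.

Lemma abs_pow_neq0 (a x : R) : x != 0%R -> abs_pow a x = (`|x| `^ a)%:E.
Proof. by rewrite /abs_pow => /negbTE ->; rewrite andbF. Qed.

Lemma abs_powM (a k x : R) : (0 < k)%R -> abs_pow a (k * x) = (k `^ a)%:E * abs_pow a x.
Proof.
move=> k0; rewrite /abs_pow mulf_eq0 gt_eqF//=; case: ifP => _.
  by rewrite gt0_muley// lte_fin powR_gt0.
by rewrite normrM gtr0_norm// powRM ?(ltW k0).
Qed.

Lemma abs_pow_norm (a x : R) : abs_pow a `|x|%R = abs_pow a x.
Proof. by rewrite /abs_pow normr_eq0 normr_id. Qed.

Lemma measurable_abs_pow (a : R) : measurable_fun [set: R] (abs_pow a).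
Proof.
apply: measurable_fun_ifT => //.
  apply: measurable_and => //.
  exact: measurable_fun_eqr.
apply/measurable_EFinP; apply: (measurableT_comp (measurable_powR a)).
exact: normr_measurable.
Qed.

(** Averaging the weights exp(-(1 + t) S / 2) over t with density t^(b-1)
    multiplies exp(-S / 2) by a negative power of S. *)
Lemma laplace_fubini d (T : measurableType d)
    (m : {sigma_finite_measure set T -> \bar R}) (S : T -> R) (G : T -> \bar R) (b : R) :
  (0 < b)%R -> measurable_fun [set: T] S -> measurable_fun [set: T] G ->
  (forall x, 0 <= G x) -> {ae m, forall x, (0 < S x)%R} ->
  \int[mu]_t ((mellin_power b t)%:E * \int[m]_x (G x * (expR (- ((1 + t) * S x / 2)))%:E)) =
  \int[m]_x (G x * (Gamma b * (S x / 2) `^ (- b) * expR (- (S x / 2)))%:E).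
Proof.
move=> b0 mS mG G0 S0.
pose H (z : measurableTypeR R * T) :=
  (mellin_power b z.1)%:E * (G z.2 * (expR (- ((1 + z.1) * S z.2 / 2)))%:E).
have H0 z : 0 <= H z by rewrite mule_ge0 ?mule_ge0 ?lee_fin ?mellin_power_ge0 ?expR_ge0.
have mH : measurable_fun setT H.
  apply: emeasurable_funM.
    by apply/measurable_EFinP; apply: measurableT_comp => //; exact: measurable_mellin_power.
  apply: emeasurable_funM; first exact: measurableT_comp.
  apply/measurable_EFinP; apply: measurableT_comp => //; apply: measurableT_comp => //.
  apply: measurable_funM => //; apply: measurable_funM.
    by apply: measurable_funD.
  exact: measurableT_comp.
transitivity (\int[mu]_t \int[m]_x H (t, x)).
  apply: eq_integral => t _; rewrite -ge0_integralZl//.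
  - apply: emeasurable_funM => //.
    apply/measurable_EFinP; apply: measurableT_comp => //; apply: measurableT_comp => //.
    by apply: measurable_funM => //; apply: measurable_funM.
  - by move=> x _; rewrite mule_ge0// lee_fin expR_ge0.
  - by rewrite lee_fin mellin_power_ge0.
rewrite (fubini_tonelli _ mH H0); apply: ge0_ae_eq_integral => //.
- exact: (measurable_fun_fubini_tonelli_G _ mH).
- apply: emeasurable_funM => //; apply/measurable_EFinP; apply: measurable_funM.
    apply: measurable_funM => //; apply: (measurableT_comp (measurable_powR (- b))).
    by apply: measurable_funM.
  apply: measurableT_comp => //; apply: measurableT_comp => //.
  by apply: measurable_funM.
- by move=> x _; apply: integral_ge0 => t _.
- move=> x _; rewrite mule_ge0// lee_fin !mulr_ge0 ?powR_ge0 ?expR_ge0//.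
  by rewrite ltW// Gamma_gt0.
apply: filterS S0 => x Sx _; rewrite /H/=.
have E t : (mellin_power b t)%:E * (G x * (expR (- ((1 + t) * S x / 2)))%:E) =
    (G x * (expR (- (S x / 2)))%:E) * (mellin_power b t * expR (- (S x / 2 * t)))%:E.
  rewrite muleCA -muleA -!EFinM; congr (_ * _%:E).
  rewrite mulrCA -expRD; congr (_ * expR _)%R; ring.
under eq_integral do rewrite E.
rewrite ge0_integralZl//.
- rewrite laplace_power ?divr_gt0// GammaE_fin// -muleA -!EFinM; congr (_ * _%:E); ring.
- by apply/measurable_EFinP; apply: measurable_funM; [exact: measurable_mellin_power|exact: measurable_expRN].
- by move=> t _; rewrite lee_fin mulr_ge0 ?mellin_power_ge0 ?expR_ge0.
- by rewrite mule_ge0// lee_fin expR_ge0.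
Qed.

(** When the Gaussian integrals of G depend on the width through a power only,
    as they do for a homogeneous G, the factor S^(-b) costs a quotient of
    Gamma values. This takes the place of integration in polar coordinates. *)
Lemma laplace_mixture d (T : measurableType d)
    (m : {sigma_finite_measure set T -> \bar R}) (S : T -> R) (G : T -> \bar R)
    (b q : R) (M : \bar R) :
  (0 < b < q)%R -> measurable_fun [set: T] S -> measurable_fun [set: T] G ->
  (forall x, 0 <= G x) -> {ae m, forall x, (0 < S x)%R} -> 0 <= M ->
  (forall t, (0 < t)%R -> \int[m]_x (G x * (expR (- ((1 + t) * S x / 2)))%:E) =
    ((1 + t) `^ (- q))%:E * M) ->
  \int[m]_x (G x * (Gamma b * (S x / 2) `^ (- b) * expR (- (S x / 2)))%:E) =
  (Gamma b * Gamma (q - b) / Gamma q)%:E * M.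
Proof.
move=> /andP[b0 bq] mS mG G0 S0 M0 hM; rewrite -laplace_fubini//.
have q0 : (0 < Gamma q)%R by apply: Gamma_gt0; lra.
transitivity (\int[mu]_t ((mellin_power b t * (1 + t) `^ (- q))%:E * M)).
  apply: eq_integral => t _.
  have [t0|t0] := ltP 0%R t; first by rewrite hM// EFinM muleA.
  by rewrite /mellin_power ltNge t0/= mul0r !mul0e.
rewrite ge0_integralZr//; first last.
- by move=> t _; rewrite lee_fin mulr_ge0 ?mellin_power_ge0 ?powR_ge0.
- apply/measurable_EFinP; apply: measurable_funM; first exact: measurable_mellin_power.
  apply: (measurableT_comp (measurable_powR (- q))) => //.
  by apply: measurable_funD.
congr (_ * _); have := betaE b q.
rewrite !GammaE_fin; [|lra..].
move=> /(congr1 (fun z => (Gamma q)^-1%:E * z)).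
rewrite muleA -!EFinM mulVf ?gt_eqF// mul1e => ->; congr (_%:E).
by rewrite mulrC.
Qed.

(** The measure sg enters only through hJ, its rotation invariance, and
    through being carried by the unit sphere. Let X be the Gaussian vector
    with S = |X|^2. The identity results from evaluating the integral of |<c,
    X>|^a S^(-b) over both c and X in two ways, b being chosen so that all
    integrals converge. *)
Lemma sphere_moment_gauss d (T : measurableType d) (sg : probability T R) (n : nat)
    (c : nat -> T -> R) (a : R) (J : \bar R) :
  (-1 < a)%R -> (forall i, measurable_fun [set: T] (c i)) -> 0 <= J ->
  {ae sg, forall w, (\sum_(i < n.+1) c i w ^+ 2 = 1)%R} ->
  (forall x : nat -> R, (0 < \sum_(i < n.+1) x i ^+ 2)%R ->
    \int[sg]_w abs_pow a (\sum_(i < n.+1) c i w * x i)%R =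
    abs_pow a (Num.sqrt (\sum_(i < n.+1) x i ^+ 2)) * J) ->
  (2 `^ (a / 2) * Num.sqrt (2 * pi) * Gamma ((n.+1%:R + a) / 2))%:E * J =
  (Gamma (n.+1%:R / 2))%:E * \int[mu]_x (abs_pow a x * (gauss_weight x)%:E).
Proof.
move=> a1 mc J0 c1 hJ.
have [d' [U [m [X [mX gX]]]]] := @gauss_space R n.
pose S (t : U) := (\sum_(i < n.+1) X i t ^+ 2)%R.
have mS : measurable_fun setT S.
  by apply: measurable_sum => i; apply: measurable_funX.
have S0 t : (0 <= S t)%R by apply: sumr_ge0 => i _; exact: sqr_ge0.
have Spos : {ae m, forall t, (0 < S t)%R}.
  (* Where S = 0 the first coordinate vanishes, and that coordinate has a
     one-dimensional Gaussian law. *)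
  pose f (v : R) : \bar R := if v == 0%R then 1 else 0.
  have mf : measurable_fun [set: R] f.
    by apply: measurable_fun_ifT => //; exact: measurable_fun_eqr.
  have f0 v : 0 <= f v by rewrite /f; case: ifP.
  have := gX (fun i => (i == 0)%N%:R) 1%R f ltr01 mf f0.
  rewrite [X in _ = _ * X](_ : _ = 0); last first.
    transitivity (\int[mu]_x (cst 0 x : \bar R)); last exact: integral0.
    apply: ge0_ae_eq_integral => //.
    - apply: emeasurable_funM; last by apply/measurable_EFinP; exact: measurable_gauss_weight.
      by apply: (measurableT_comp mf); apply: measurable_funM.
    - by move=> x _; rewrite mule_ge0// lee_fin gauss_weight_ge0.
    exists [set 0%R]; split; [exact: measurable_set1|exact: lebesgue_measure_set1|].
    move=> x /= /not_implyP[_ h]; apply: contrapT => /eqP x0; apply: h.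
    rewrite /f big_ord_recl/= big1 => [|i _]; last by rewrite expr0n.
    by rewrite addr0 expr1n sqrtr1 divr1 mul1r (negbTE x0) mul0e.
  rewrite mule0 => h.
  have mh : measurable_fun [set: U] (fun t => f (\sum_(i < n.+1) (i == 0 :> nat)%:R * X i t)%R *
     (expR (- (1 ^+ 2 * S t / 2)))%:E).
    apply: emeasurable_funM.
      apply: (measurableT_comp mf); apply: measurable_sum => i.
      by apply: measurable_funM.
    apply/measurable_EFinP; apply: measurableT_comp => //; apply: measurableT_comp => //.
    by apply: measurable_funM => //; apply: measurable_funM.
  have := (ae_eq_integral_abs m measurableT mh).1.
  under eq_integral => t _ do rewrite gee0_abs ?mule_ge0 ?lee_fin ?expR_ge0//.
  move=> /(_ h); apply: filterS => t /= /(_ I).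
  rewrite /f /S !big_ord_recl/= mul1r big1 => [|i _]; last by rewrite mul0r.
  rewrite addr0; case: eqP => [_|/eqP X0 _].
    by rewrite mul1e => -[/eqP]; rewrite gt_eqF ?expR_gt0.
  rewrite ltr_wpDr ?exprn_even_gt0//.
  by apply: sumr_ge0 => i _; exact: sqr_ge0.
pose N : R := n.+1%:R.
have N1 : (1 <= N)%R by rewrite /N ler1n.
(* The two radial exponents b' and b = b' + a/2 must satisfy 0 < b' < N/2
   and 0 < b. The choice below works since k < 1 <= N and k >= -a. *)
pose k := (Num.max 0 (- a))%R.
have [k0 ka k1] : [/\ (0 <= k)%R, (- a <= k)%R & (k < 1)%R].
  by rewrite /k; split; [rewrite le_max lexx|rewrite le_max lexx orbT|rewrite gt_max ltr01; lra].
pose b' := ((1 + k) / 4)%R; pose b := (b' + a / 2)%R.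
have b'0 : (0 < b')%R by rewrite /b'; lra.
have b'N : (b' < N / 2)%R by rewrite /b'; lra.
have b0 : (0 < b)%R by rewrite /b /b'; lra.
have bNa : (0 < b < (N + a) / 2)%R by rewrite b0 /b; lra.
have N20 : (0 < N / 2)%R by clear -N1; lra.
have Na20 : (0 < (N + a) / 2)%R by clear -N1 a1; lra.
have Nb0 : (0 < N / 2 - b')%R by rewrite subr_gt0.
pose kap : R := Num.sqrt (2 * pi).
have kap0 : (0 < kap)%R by rewrite sqrtr_gt0 mulr_gt0// pi_gt0.
pose V := \int[m]_t ((S t / 2) `^ (- b') * expR (- (S t / 2)))%:E.
pose Ma := \int[mu]_x (abs_pow a x * (gauss_weight x)%:E).
have GN : (0 < Gamma (N / 2))%R by exact: Gamma_gt0.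
have GNa : (0 < Gamma ((N + a) / 2))%R by exact: Gamma_gt0.
have Gb : (0 < Gamma b)%R by exact: Gamma_gt0.
have Gb' : (0 < Gamma b')%R by exact: Gamma_gt0.
have GNb : (0 < Gamma (N / 2 - b'))%R by exact: Gamma_gt0.
have rN (t q : R) : (0 < t)%R -> (Num.sqrt (1 + t) ^- n.+1 * Num.sqrt (1 + t) `^ (- q) = (1 + t) `^ (- ((N + q) / 2)))%R.
  move=> t0; have t10 : (0 < 1 + t)%R by rewrite addr_gt0.
  rewrite -powR_invn ?sqrtr_ge0// -powRD ?(gt_eqF (_ : (0 < Num.sqrt (1 + t))%R)) ?implybT ?sqrtr_gt0//.
  by rewrite -powR12_sqrt ?(ltW t10)// -powRrM; congr (_ `^ _)%R; rewrite -/N; field.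
have mV : measurable_fun [set: U] (fun t => ((S t / 2) `^ (- b') * expR (- (S t / 2)))%:E).
  apply/measurable_EFinP; apply: measurable_funM.
    apply: (measurableT_comp (measurable_powR (- b'))).
    by apply: measurable_funM.
  apply: measurableT_comp => //; apply: measurableT_comp => //.
  by apply: measurable_funM.
have V0 t : 0 <= ((S t / 2) `^ (- b') * expR (- (S t / 2)))%:E.
  by rewrite lee_fin mulr_ge0 ?powR_ge0 ?expR_ge0.
have Ma0 : 0 <= Ma.
  by apply: integral_ge0 => x _; rewrite mule_ge0 ?abs_pow_ge0// lee_fin gauss_weight_ge0.
(* The Gaussian integral of S^(-b'), from the constant function G = 1. *)
have V1 : V = (kap ^+ n.+1 * Gamma (N / 2 - b') / Gamma (N / 2))%:E.
  have := @laplace_mixture _ _ m S (cst 1) b' (N / 2) (kap ^+ n.+1)%:E.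
  rewrite b'0 b'N => /(_ isT mS (@measurable_cst _ _ _ _ _ _) (fun=> lee01) Spos).
  rewrite lee_fin exprn_ge0 ?(ltW kap0)// => /(_ isT) h.
  have {h} : (Gamma b')%:E * V = (Gamma b' * Gamma (N / 2 - b') / Gamma (N / 2))%:E * (kap ^+ n.+1)%:E.
    rewrite -h.
    - rewrite -(ge0_integralZl m measurableT mV)//; last by rewrite lee_fin ltW.
      by apply: eq_integral => t _; rewrite mul1e -EFinM mulrA.
    - move=> t t0.
      have := gX (fun=> 0%R) (Num.sqrt (1 + t)) (cst 1) _ (@measurable_cst _ _ _ _ _ _) (fun=> lee01).
      have t10 : (0 < 1 + t)%R by rewrite addr_gt0.
      rewrite sqrtr_gt0 sqr_sqrtr ?(ltW t10)// => /(_ t10) ->.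
      under eq_integral do rewrite mul1e.
      rewrite integral_gauss_weight -!EFinM -/kap; congr (_%:E).
      have := rN t 0%R t0; rewrite oppr0 powRr0 mulr1 addr0 => ->.
      by rewrite exprS; ring.
  move=> /(congr1 (fun z => (Gamma b')^-1%:E * z)).
  rewrite muleA -!EFinM mulVf ?gt_eqF// mul1e => ->; congr (_%:E).
  by rewrite !mulrA mulVf ?gt_eqF// mul1r mulrC mulrA.
(* Integrating in c first gives the left-hand side, integrating in X first
   the right-hand side. *)
have V2 : J * (Gamma b * 2 `^ (a / 2))%:E * V =
   (kap ^+ n * Gamma b * Gamma (N / 2 - b') / Gamma ((N + a) / 2))%:E * Ma.
  pose F (z : U * T) := abs_pow a (\sum_(i < n.+1) c i z.2 * X i z.1)%R.
  have mF : measurable_fun setT F.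
    apply: (measurableT_comp (measurable_abs_pow a)); apply: measurable_sum => i.
    by apply: measurable_funM; apply: measurableT_comp.
  have F0 z : 0 <= F z by exact: abs_pow_ge0.
  pose G t := \int[sg]_w F (t, w).
  have mG : measurable_fun setT G by exact: (measurable_fun_fubini_tonelli_F _ mF).
  have G0 t : 0 <= G t by apply: integral_ge0.
  have := @laplace_mixture _ _ m S G b ((N + a) / 2) ((kap ^+ n)%:E * Ma) bNa mS mG G0 Spos.
  rewrite mule_ge0 ?lee_fin ?exprn_ge0 ?(ltW kap0)// => /(_ isT) h.
  rewrite [RHS](_ : _ = \int[m]_x (G x * (Gamma b * (S x / 2) `^ (- b) * expR (- (S x / 2)))%:E)).
    rewrite -(ge0_integralZl m measurableT mV)//; last by rewrite mule_ge0// lee_fin mulr_ge0 ?powR_ge0 ?ltW.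
    apply: ge0_ae_eq_integral => //.
    - by apply: emeasurable_funM.
    - apply: emeasurable_funM => //.
      apply/measurable_EFinP; apply: measurable_funM.
        apply: measurable_funM => //.
        apply: (measurableT_comp (measurable_powR (- b))).
        by apply: measurable_funM.
      apply: measurableT_comp => //; apply: measurableT_comp => //.
      by apply: measurable_funM.
    - by move=> t _; rewrite mule_ge0// mule_ge0// lee_fin mulr_ge0 ?powR_ge0 ?ltW.
    - by move=> t _; rewrite mule_ge0// lee_fin !mulr_ge0 ?powR_ge0 ?expR_ge0 ?(ltW Gb).
    apply: filterS Spos => t St _.
    rewrite /G /F/= (hJ (X^~ t))// abs_pow_neq0 ?gt_eqF ?sqrtr_gt0//.
    rewrite muleAC -muleA [RHS]muleAC [RHS]muleC -!EFinM; congr (_ * _%:E).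
    rewrite ger0_norm ?sqrtr_ge0// -powR12_sqrt ?S0// -/(S t).
    have -> : ((S t `^ 2^-1) `^ a = S t `^ (a / 2))%R by rewrite -powRrM mulrC.
    have -> : (S t `^ (a / 2) = 2 `^ (a / 2) * (S t / 2) `^ (a / 2))%R.
      by rewrite -powRM ?divr_ge0 ?S0// mulrCA divff ?mulr1.
    have -> : ((S t / 2) `^ (- b') = (S t / 2) `^ (a / 2) * (S t / 2) `^ (- b))%R.
      rewrite -powRD ?(gt_eqF (divr_gt0 St (ltr0Sn _ 1))) ?implybT//.
      by congr (_ `^ _)%R; rewrite /b opprD addrCA subrr addr0.
    by move: (Gamma b) => gb; clear; ring.
  rewrite h.
    rewrite muleA -EFinM; congr (_%:E * _).
    rewrite (_ : (N + a) / 2 - b = N / 2 - b')%R; last first.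
      by rewrite /b mulrDl opprD addrACA subrr addr0.
    by move: (Gamma b) (Gamma ((N + a) / 2)) (Gamma (N / 2 - b')) => *; clear; ring.
  move=> t t0.
  have t10 : (0 < 1 + t)%R by rewrite addr_gt0.
  pose r := Num.sqrt (1 + t).
  have r0 : (0 < r)%R by rewrite sqrtr_gt0.
  pose H (z : U * T) := F z * (expR (- ((1 + t) * S z.1 / 2)))%:E.
  have mH : measurable_fun setT H.
    apply: emeasurable_funM => //; apply/measurable_EFinP.
    apply: measurableT_comp => //; apply: measurableT_comp => //.
    apply: measurable_funM => //; apply: measurable_funM => //.
    exact: measurableT_comp.
  have H0 z : 0 <= H z by rewrite mule_ge0// lee_fin expR_ge0.
  transitivity (\int[m]_x \int[sg]_w H (x, w)).
    apply: eq_integral => x _; rewrite /H/= ge0_integralZr//.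
    exact: measurableT_comp.
  rewrite (fubini_tonelli _ mH H0).
  transitivity (\int[sg]_w (cst (((1 + t) `^ (- ((N + a) / 2)))%:E * ((kap ^+ n)%:E * Ma)) w)); last first.
    by rewrite -[RHS]mule1 -(probability_setT sg); apply: integral_cst.
  apply: ge0_ae_eq_integral => //.
  - exact: (measurable_fun_fubini_tonelli_G _ mH).
  - by move=> w _; apply: integral_ge0.
  - by move=> w _; rewrite /= mule_ge0 ?mule_ge0 ?lee_fin ?powR_ge0 ?exprn_ge0 ?(ltW kap0).
  apply: filterS c1 => w cw _; rewrite /H/= /F/=.
  have := gX (c^~ w) r (abs_pow a) r0 (measurable_abs_pow a) (@abs_pow_ge0 a).
  rewrite cw sqrtr1 sqr_sqrtr ?(ltW t10)// => ->.
  have E x : abs_pow a (1 / r * x)%R * (gauss_weight x)%:E = (r `^ (- a))%:E * (abs_pow a x * (gauss_weight x)%:E).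
    rewrite abs_powM ?divr_gt0// div1r -muleA; congr (_%:E * _).
    by rewrite -powR_inv1 ?(ltW r0)// -powRrM mulN1r.
  under eq_integral do rewrite E.
  rewrite ge0_integralZl//; last 3 first.
  - apply: emeasurable_funM; first exact: measurable_abs_pow.
    by apply/measurable_EFinP; exact: measurable_gauss_weight.
  - by move=> x _; rewrite mule_ge0 ?abs_pow_ge0// lee_fin gauss_weight_ge0.
  - by rewrite lee_fin powR_ge0.
  rewrite -/Ma !muleA -!EFinM; congr (_%:E * _).
  by rewrite -/kap -mulrA rN// mulrC.
move: V2; rewrite V1 -/Ma -/kap -/N.
move: (Gamma b) (Gamma (N / 2)) (Gamma ((N + a) / 2)) (Gamma (N / 2 - b')) Gb GN GNa GNb.
clear -kap0 => g1 g2 g3 g4 G1 G2 G3 G4.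
move: (2 `^ (a / 2))%R => g5.
rewrite -muleA -EFinM muleC.
move=> /(congr1 (fun z => (g2 * g3 / (kap ^+ n * g1 * g4))%:E * z)).
have kn0 : (kap ^+ n != 0)%R by rewrite expf_neq0 ?gt_eqF.
rewrite exprS; move: (kap ^+ n)%R kn0 => kn kn0.
rewrite !muleA -!EFinM => h; congr (_%:E * _ = _%:E * _): h.
  by clear -G1 G2 G3 G4 kn0; field; rewrite kn0 !gt_eqF.
by clear -G1 G2 G3 G4 kn0; field; rewrite kn0 !gt_eqF.
Qed.

End sphere_moments.

Section sphere_moments_closed.
Context {R : realType}.
Local Notation mu := (@lebesgue_measure R).
Local Open Scope ereal_scope.

(** A unit point mass with c = 1 satisfies the hypotheses of sphere_moment_gauss in
    dimension 0, with J = 1. *)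
Lemma gauss_moment_half (a : R) : (-1 < a)%R ->
  (2 `^ (a / 2) * Num.sqrt (2 * pi) * Gamma ((1 + a) / 2))%:E =
  (Gamma (1 / 2))%:E * \int[mu]_x (abs_pow a x * (gauss_weight x)%:E).
Proof.
move=> a1.
have := @sphere_moment_gauss R _ unit (\d_tt : probability unit R) 0 (fun _ _ => 1%R) a 1 a1.
rewrite mule1; apply => //.
- by apply: nearW => w; rewrite big_ord1 expr1n.
- move=> x _; rewrite !big_ord1 mul1r mule1 sqrtr_sqr abs_pow_norm.
  rewrite -[RHS]mule1 -(probability_setT (\d_tt : probability unit R)).
  exact: integral_cst.
Qed.

Lemma continuous_gauss_weight : continuous (@gauss_weight R).
Proof.
move=> x; apply: continuous_comp; last exact: continuous_expR.
apply: (@continuousN _ R^o); apply: (@cvgMr_tmp R); exact: sqr_continuous.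
Qed.

Lemma gauss_abs_moment : \int[mu]_x (abs_pow 1 x * (gauss_weight x)%:E) = 2%:E.
Proof.
have cf : continuous (fun x : R => `|x| * gauss_weight x)%R.
  by move=> x; apply: cvgM; [exact: norm_continuous|exact: continuous_gauss_weight].
rewrite [LHS](_ : _ = \int[mu]_x (`|x| * gauss_weight x)%:E); last first.
  apply: eq_integral => x _; rewrite /abs_pow ltNge ler01/=.
  by rewrite powRr1 ?normr_ge0.
rewrite ge0_symfun_integralT//; first last.
- by move=> x /=; rewrite normrN /gauss_weight sqrrN.
- by move=> x; rewrite mulr_ge0 ?gauss_weight_ge0.
rewrite -set_itvcy.
rewrite (@ge0_continuous_FTC2y R _ (fun x => - gauss_weight x)%R 0 0).
- by rewrite /gauss_weight expr0n/= mul0r oppr0 expR0 opprK add0e mule1.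
- by move=> x _; rewrite mulr_ge0 ?gauss_weight_ge0.
- exact: continuous_subspaceT.
- rewrite -oppr0; apply: (@cvgN _ R^o).
  apply: (@squeeze_cvgr _ _ _ _ (cst 0%R) (fun x : R => expR (- x))).
  + near=> x; rewrite gauss_weight_ge0/= ler_expR lerN2 ler_pdivlMr// mulrC expr2.
    rewrite ler_pM2r; near: x; [exact: nbhs_pinfty_ge|exact: nbhs_pinfty_gt].
  + exact: cvg_cst.
  + exact: cvgr_expR.
- by move=> x _; rewrite /gauss_weight; exact: ex_derive.
- apply: cvg_at_right_filter; apply: (@cvgN _ R^o); exact: continuous_gauss_weight.
- move=> x; rewrite in_itv/= andbT => x0.
  by rewrite derive1E /gauss_weight derive_val gtr0_norm// /GRing.scale/=; field.
Unshelve. all: end_near. Qed.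

(** The first absolute moment of the Gaussian weight is elementary, so
    gauss_moment_half at a = 1 determines Gamma(1/2). *)
Lemma Gamma_half : Gamma (1 / 2) = Num.sqrt pi :> R.
Proof.
have a1 : (-1 < 1 :> R)%R by lra.
have := gauss_moment_half _ a1; rewrite gauss_abs_moment -EFinM.
move=> /(congr1 (@fine R)) /=.
rewrite (_ : (1 + 1) / 2 = 1)%R; last by field.
rewrite Gamma1 mulr1 div1r powR12_sqrt// sqrtrM// mulrA -expr2 sqr_sqrtr// mulrC.
have t0 : (2 != 0 :> R)%R by rewrite pnatr_eq0.
by move=> /(mulIf t0) ->.
Qed.

Lemma sphere_moment_closed d (T : measurableType d) (sg : probability T R) (n : nat)
    (c : nat -> T -> R) (a : R) (J : \bar R) :
  (-1 < a)%R -> (forall i, measurable_fun [set: T] (c i)) -> 0 <= J ->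
  {ae sg, forall w, (\sum_(i < n.+1) c i w ^+ 2 = 1)%R} ->
  (forall x : nat -> R, (0 < \sum_(i < n.+1) x i ^+ 2)%R ->
    \int[sg]_w abs_pow a (\sum_(i < n.+1) c i w * x i)%R =
    abs_pow a (Num.sqrt (\sum_(i < n.+1) x i ^+ 2)) * J) ->
  J = (Gamma ((a + 1) / 2) * Gamma ((n%:R + 1) / 2)
       / (Num.sqrt pi * Gamma ((a + n%:R + 1) / 2)))%:E.
Proof.
move=> a1 mc J0 c1 hJ.
have h1 := sphere_moment_gauss _ _ _ _ _ _ _ a1 mc J0 c1 hJ.
have h0 := gauss_moment_half _ a1.
have n0 : (0 <= n%:R :> R)%R by [].
have gN : (0 < Gamma ((n.+1%:R + a) / 2))%R by apply: Gamma_gt0; rewrite -(natr1 n); lra.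
have k0 : (0 < Num.sqrt (2 * pi) :> R)%R by rewrite sqrtr_gt0 mulr_gt0// pi_gt0.
have p0 : (0 < Num.sqrt pi :> R)%R by rewrite sqrtr_gt0 pi_gt0.
have s0 : (0 < 2 `^ (a / 2) :> R)%R by rewrite powR_gt0.
rewrite Gamma_half in h0; rewrite -(natr1 n) in h1 gN.
rewrite (_ : (1 + a) / 2 = (a + 1) / 2)%R in h0; last by rewrite addrC.
rewrite (_ : (n%:R + 1 + a) / 2 = (a + n%:R + 1) / 2)%R in h1 gN; last by rewrite addrC addrA.
move: h1 h0 gN; move: (Gamma _) (Gamma ((n%:R + 1) / 2)) (Gamma ((a + 1) / 2)) => g1 g2 g3.
move: (\int[mu]_x _) => Ma h1 h0 g10.
have MaE : Ma = ((2 `^ (a / 2) * Num.sqrt (2 * pi) * g3) / Num.sqrt pi)%:E.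
  rewrite mulrC EFinM h0 muleA -EFinM mulVf ?mul1e// gt_eqF//.
move: h1; rewrite {}MaE -EFinM.
move=> /(congr1 (fun z => (2 `^ (a / 2) * Num.sqrt (2 * pi) * g1)^-1%:E * z)).
rewrite muleA -!EFinM mulVf ?mul1e; last by rewrite !mulf_neq0 ?gt_eqF.
move=> ->; congr (_%:E).
move: (2 `^ (a / 2))%R (Num.sqrt (2 * pi)) (Num.sqrt pi) s0 k0 p0 => x y z x0 y0 z0.
by clear -x0 y0 z0 g10; field; rewrite !gt_eqF.
Qed.

End sphere_moments_closed.

Set Implicit Arguments.
Unset Strict Implicit.
Unset Printing Implicit Defensive.

(** * The inner product of square integrable functions *)

Section L2.
Context d (T : measurableType d) (R : realType) (mu : {measure set T -> \bar R}).
Local Notation L2 := (LspaceType2 mu).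
Implicit Types (u v w : L2) (a : R).

Local Notation dot u v := (L2_dot mu (u : L2) (v : L2)).

Lemma L2_mul_integrable u v : mu.-integrable [set: T] (EFin \o (fun x => u x * v x)).
Proof. by apply/Lfun1_integrable; apply: Lfun2_mul_Lfun1; exact: L2_Lfun. Qed.

Lemma L2_dot_fin u v : (\int[mu]_x (u x * v x)%:E)%E = (dot u v)%:E.
Proof.
rewrite /L2_dot /Rintegral fineK//.
exact: (integrable_fin_num measurableT (L2_mul_integrable u v)).
Qed.

Lemma L2_dotC u v : (dot u v) = (dot v u).
Proof. by apply: eq_Rintegral => x _; rewrite mulrC. Qed.

Lemma L2_dotDl u v w : (dot (u + v) w) = (dot u w) + (dot v w).
Proof.
apply/EFin_inj; rewrite (EFinD (dot u w)) -!L2_dot_fin -integralD//; last 2 first.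
- exact: L2_mul_integrable.
- exact: L2_mul_integrable.
apply: ae_eq_integral => //.
- by apply/measurable_EFinP; apply: measurable_funM; exact: measurable_L2.
- by apply: emeasurable_funD; apply/measurable_EFinP; apply: measurable_funM; exact: measurable_L2.
by apply: filterS (L2_addE u v) => x -> _; rewrite -EFinD -mulrDl.
Qed.

Lemma L2_dotZl a u v : (dot (a *: u) v) = a * (dot u v).
Proof.
apply/EFin_inj; rewrite (EFinM a) -!L2_dot_fin -integralZl//; last exact: L2_mul_integrable.
apply: ae_eq_integral => //.
- by apply/measurable_EFinP; apply: measurable_funM; exact: measurable_L2.
- by apply: measurable_funeM; apply/measurable_EFinP; apply: measurable_funM; exact: measurable_L2.
by apply: filterS (L2_scaleE a u) => x -> _; rewrite -EFinM mulrA.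
Qed.

Lemma L2_dotDr u v w : (dot u (v + w)) = (dot u v) + (dot u w).
Proof. by rewrite L2_dotC L2_dotDl !(L2_dotC u). Qed.

Lemma L2_dotZr a u v : (dot u (a *: v)) = a * (dot u v).
Proof. by rewrite L2_dotC L2_dotZl L2_dotC. Qed.

Lemma L2_dotNl u v : (dot (- u) v) = - (dot u v).
Proof. by rewrite -scaleN1r L2_dotZl mulN1r. Qed.

Lemma L2_dotNr u v : (dot u (- v)) = - (dot u v).
Proof. by rewrite L2_dotC L2_dotNl L2_dotC. Qed.

Lemma L2_dot0l u : (dot 0 u) = 0.
Proof. by rewrite -(scale0r u) L2_dotZl mul0r. Qed.

Lemma L2_dot_suml (I : Type) (r : seq I) (F : I -> L2) v :
  (dot (\sum_(i <- r) F i) v) = \sum_(i <- r) (dot (F i) v).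
Proof.
elim: r => [|i r IH]; first by rewrite !big_nil L2_dot0l.
by rewrite !big_cons L2_dotDl IH.
Qed.

Lemma L2_dot_ge0 u : 0 <= (dot u u).
Proof. by apply: Rintegral_ge0 => x _; rewrite -expr2 sqr_ge0. Qed.

Lemma L2_dot_eq0 u : (dot u u) = 0 -> u = 0.
Proof.
move=> h; apply: eq_L2_ae.
have : (\int[mu]_x `|(u x * u x)%:E|)%E = 0%E.
  by rewrite -[RHS]/(0%:E) -h -L2_dot_fin; apply: eq_integral => x _; rewrite gee0_abs// lee_fin -expr2 sqr_ge0.
have m : measurable_fun [set: T] (fun x => (u x * u x)%:E).
  by apply/measurable_EFinP; apply: measurable_funM; exact: measurable_L2.
move/(ae_eq_integral_abs mu measurableT m).
apply: filterS2 (L2_zeroE mu) => x -> /(_ I) /= -[/eqP].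
by rewrite mulf_eq0 orbb => /eqP.
Qed.

Lemma L2_normE u : L2_norm u = Num.sqrt (dot u u).
Proof.
rewrite /L2_norm unlock /=.
have -> : (\int[mu]_x `|(EFin \o u) x| `^ 2 = (dot u u)%:E)%E.
  rewrite -L2_dot_fin; apply: eq_integral => x _.
  by rewrite /= powR_mulrn// real_normK ?num_real// expr2.
by rewrite poweR_EFin/= powR12_sqrt// L2_dot_ge0.
Qed.

Lemma L2_norm_ge0 u : 0 <= L2_norm u.
Proof. by rewrite L2_normE sqrtr_ge0. Qed.

Lemma L2_normK u : L2_norm u ^+ 2 = (dot u u).
Proof. by rewrite L2_normE sqr_sqrtr// L2_dot_ge0. Qed.

(** The squared norm of u minus its projection on v is nonnegative. *)
Lemma L2_CS u v : `|(dot u v)| <= L2_norm u * L2_norm v.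
Proof.
have [v0|v0] := eqVneq (dot v v) 0.
  by rewrite (L2_dot_eq0 v0) L2_dotC L2_dot0l normr0 mulr_ge0 ?L2_norm_ge0.
have vp : 0 < (dot v v) by rewrite lt0r v0 L2_dot_ge0.
have h := L2_dot_ge0 (u - ((dot u v) / (dot v v)) *: v).
have {}h : (dot u v) ^+ 2 <= (dot u u) * (dot v v).
  move: h; rewrite !(L2_dotDl, L2_dotDr, L2_dotNl, L2_dotNr, L2_dotZl, L2_dotZr) (L2_dotC v u).
  set s := (dot u v); set q := (dot v v) in vp v0 *; set p := (dot u u).
  have -> : p - s / q * s + (- (s / q * s) - - (s / q * (s / q * q))) = p - s ^+ 2 / q.
    by field.
  by rewrite subr_ge0 ler_pdivrMr.
rewrite -(ler_pXn2r (n := 2)) ?nnegrE ?mulr_ge0 ?L2_norm_ge0//.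
by rewrite exprMn !L2_normK real_normK ?num_real.
Qed.

Lemma L2_norm_sub u v : `|L2_norm u - L2_norm v| <= L2_norm (u - v).
Proof.
rewrite -(ler_pXn2r (n := 2)) ?nnegrE ?L2_norm_ge0//.
rewrite real_normK ?num_real// sqrrB !L2_normK.
rewrite !(L2_dotDl, L2_dotDr, L2_dotNl, L2_dotNr) (L2_dotC v u).
have := le_trans (ler_norm _) (L2_CS u v).
move: (L2_norm u) (L2_norm v) (dot u v) (dot u u) (dot v v) => x y p q r.
by clear; rewrite mulr2n; lra.
Qed.

(** The preimage of an open ray is open for the norm, hence a generator of the
    Borel sigma-algebra. *)
Lemma L2_lipschitz_measurable (f : L2_borel mu -> R) (K : R) : 0 < K ->
  (forall u v : L2, `|f u - f v| <= K * L2_norm (u - v)) ->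
  measurable_fun [set: L2_borel mu] f.
Proof.
move=> K0 hf; apply: (measurability _ (RGenOInfty.measurableE R)) => _ [_ [x ->] <-].
rewrite setTI; apply: sub_sigma_algebra => u /=; rewrite in_itv/= andbT => xu.
exists ((f u - x) / K); first by rewrite divr_gt0// subr_gt0.
move=> v; rewrite ltr_pdivlMr// mulrC => h.
rewrite /= in_itv/= andbT; have := le_lt_trans (hf v u) h.
by rewrite ltr_norml => /andP[]; rewrite opprB ltrBlDr subrK.
Qed.

Lemma measurable_L2_dot v : measurable_fun [set: L2_borel mu] (fun u : L2_borel mu => (dot ((u : L2)) v)).
Proof.
apply: (@L2_lipschitz_measurable _ (L2_norm v + 1)).
  by rewrite ltr_wpDl ?L2_norm_ge0.
move=> u w; rewrite -L2_dotNl -L2_dotDl; apply: le_trans (L2_CS _ _) _.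
by rewrite mulrC ler_wpM2r ?L2_norm_ge0// lerDl.
Qed.

Lemma measurable_L2_norm : measurable_fun [set: L2_borel mu] (fun u : L2_borel mu => L2_norm (u : L2)).
Proof.
by apply: (@L2_lipschitz_measurable _ 1) => // u v; rewrite mul1r; exact: L2_norm_sub.
Qed.

(** The reflection in the hyperplane orthogonal to v. It is the identity when
    v is the null vector, since division by 0 gives 0. *)
Definition L2_refl v u : L2 := u - (2 * (dot u v) / (dot v v)) *: v.

Lemma L2_refl_linear v a u w : L2_refl v (a *: u + w) = a *: L2_refl v u + L2_refl v w.
Proof.
rewrite /L2_refl L2_dotDl L2_dotZl scalerBr scalerA addrACA; congr (_ + _).
rewrite -!scaleNr -scalerDl; congr (_ *: _).
by move: (dot u v) (dot w v) (dot v v) => p q r; rewrite /GRing.scale/=; ring.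
Qed.

Lemma L2_refl_dot v u w : (dot (L2_refl v u) (L2_refl v w)) = (dot u w).
Proof.
have [v0|v0] := eqVneq (dot v v) 0.
  by rewrite /L2_refl v0 invr0 !mulr0 !scale0r !subr0.
rewrite /L2_refl !(L2_dotDl, L2_dotDr, L2_dotNl, L2_dotNr, L2_dotZl, L2_dotZr).
by rewrite (L2_dotC v w); field.
Qed.

Lemma measurable_L2_refl v :
  measurable_fun [set: L2_borel mu] (L2_refl v : L2_borel mu -> L2_borel mu).
Proof.
apply: (@measurability _ _ (L2_borel mu) (L2_borel mu) setT (L2_refl v) (@L2_open d T R mu)) => [|_ [A oA <-]]; first by [].
rewrite setTI; apply: sub_sigma_algebra => u /= /oA [r r0 h].
exists r => // w hw; apply: h.
have -> : L2_refl v w - L2_refl v u = L2_refl v (w - u).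
  have := L2_refl_linear v (-1) u w; rewrite !scaleN1r addrC => ->.
  by rewrite addrC.
by rewrite L2_normE L2_refl_dot -L2_normE.
Qed.

(** Reflections alone carry any vector to the axis of a given unit vector, so
    they are the only isometries that the invariance of the sphere measure has
    to be used for. *)
Lemma L2_refl_axis w e : (dot e e) = 1 -> let n := L2_norm w in
  L2_refl (w - n *: e) w = n *: e.
Proof.
move=> e1 n; set v := w - n *: e.
have n2 : n ^+ 2 = (dot w w) by rewrite /n L2_normK.
have vv : (dot v v) = 2 * (dot w v).
  rewrite /v !(L2_dotDl, L2_dotDr, L2_dotNl, L2_dotNr, L2_dotZl, L2_dotZr) e1 (L2_dotC e w) -n2.
  by ring.
have [v0|v0] := eqVneq (dot v v) 0.
  have /eqP := L2_dot_eq0 v0; rewrite subr_eq0 => /eqP wn.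
  by rewrite /L2_refl v0 invr0 mulr0 scale0r subr0.
by rewrite /L2_refl -vv divff// scale1r /v opprB addrC subrK.
Qed.

End L2.

(** * Orthonormal bases *)

Section onb.
Context d (T : measurableType d) (R : realType) (mu : {measure set T -> \bar R}).
Local Notation L2 := (LspaceType2 mu).
Local Notation dot u v := (L2_dot mu (u : L2) (v : L2)).

Definition L2_orthonormal (k : nat) (e : nat -> L2) :=
  forall i j, (i < k)%N -> (j < k)%N -> dot (e i) (e j) = (i == j)%:R.

Lemma orthonormal_coord k e (c : nat -> R) j : L2_orthonormal k e -> (j < k)%N ->
  dot (\sum_(i < k) c i *: e i) (e j) = c j.
Proof.
move=> oe jk; rewrite L2_dot_suml (bigD1 (Ordinal jk))//= big1 => [|i ij].
  by rewrite L2_dotZl oe// eqxx mulr1 addr0.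
by rewrite L2_dotZl oe// -[j]/(val (Ordinal jk)) val_eqE (negbTE ij) mulr0.
Qed.

Lemma linear_subspace_sum (E : set L2) (I : finType) (c : I -> R) (f : I -> L2) :
  linear_subspace E -> (forall i, E (f i)) -> E (\sum_i c i *: f i).
Proof.
move=> [E0 EL] Ef.
by elim/big_rec: _ => // i u _ Eu; exact: EL.
Qed.

(** Gram-Schmidt orthonormalisation of a basis b of E. The induction also
    records that e_l is a combination of b_0, ..., b_l, so that by
    independence the residue of the next basis vector is not 0, and that every
    treated b_i is a combination of the e_l, so that in the end they span E. *)
Lemma exists_orthonormal_basis (E : set L2) (k : nat) :
  linear_subspace E -> has_dim E k -> exists e : nat -> L2,
  [/\ forall i, (i < k)%N -> E (e i), L2_orthonormal k e &
      forall u, E u -> u = \sum_(i < k) dot u (e i) *: e i].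
Proof.
move=> linE [b [indep spanE]].
have Eb i : E (b i).
  rewrite spanE; exists (fun j => (j == i)%:R) => //.
  rewrite (bigD1 i)//= eqxx scale1r big1 ?addr0// => j ji.
  by rewrite (negbTE ji) scale0r.
have bcoef (c1 c2 : 'I_k -> R) : \sum_i c1 i *: b i = \sum_i c2 i *: b i -> forall i, c1 i = c2 i.
  move=> /eqP; rewrite -subr_eq0 -sumrB => /eqP h i.
  apply/eqP; rewrite -subr_eq0; apply/eqP.
  apply: (indep (fun i => c1 i - c2 i)); rewrite -[RHS]h.
  by apply: eq_bigr => j _; rewrite scalerBl.
suff H j : (j <= k)%N -> exists e : nat -> L2,
    [/\ L2_orthonormal j e,
        forall l, (l < j)%N -> exists c : 'I_k -> R, (forall i : 'I_k, (j <= i)%N -> c i = 0) /\ e l = \sum_i c i *: b i &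
        forall i : 'I_k, (i < j)%N -> exists c : nat -> R, b i = \sum_(l < j) c l *: e l].
  have [e [oe eb be]] := H k (leqnn k).
  exists e; split => //.
    by move=> i /eb [c [_ ->]]; exact: linear_subspace_sum.
  move=> u; rewrite {1}spanE => -[c _ <-].
  have [C hC] := choice (fun i => be i (ltn_ord i)).
  have E1 : \sum_i c i *: b i = \sum_(l < k) (\sum_i c i * C i l) *: e l.
    under eq_bigr do rewrite hC scaler_sumr.
    rewrite exchange_big/=; apply: eq_bigr => l _.
    by rewrite scaler_suml; apply: eq_bigr => i _; rewrite scalerA.
  rewrite E1; apply: eq_bigr => l _; congr (_ *: _).
  by rewrite (@orthonormal_coord k e (fun l => \sum_i c i * C i l)).
elim: j => [_|j IH jk].
  by exists (fun=> 0); split.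
have [e [oe eb be]] := IH (ltnW jk).
pose bj := b (Ordinal jk).
pose p := \sum_(l < j) dot bj (e l) *: e l.
(* The residue of the next basis vector. *)
pose w := bj - p.
have [C hC] : {C : nat -> 'I_k -> R & forall l, (l < j)%N ->
    (forall i : 'I_k, (j <= i)%N -> C l i = 0) /\ e l = \sum_i C l i *: b i}.
  apply: (@choice _ _ (fun l c => (l < j)%N -> (forall i : 'I_k, (j <= i)%N -> c i = 0) /\ e l = \sum_i c i *: b i)) => l.
  by case: (ltnP l j) => [/eb [c hc]|_]; [exists c|exists (fun=> 0)].
pose cp (i : 'I_k) := \sum_(l < j) dot bj (e l) * C l i.
have pE : p = \sum_i cp i *: b i.
  rewrite /p; under eq_bigr => l _ do rewrite (hC l (ltn_ord l)).2 scaler_sumr.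
  rewrite exchange_big/=; apply: eq_bigr => i _.
  by rewrite /cp scaler_suml; apply: eq_bigr => l _; rewrite scalerA -(hC l (ltn_ord l)).2.
have cp0 (i : 'I_k) : (j <= i)%N -> cp i = 0.
  by move=> ji; rewrite /cp big1// => l _; rewrite (hC l (ltn_ord l)).1// mulr0.
have bjE : bj = \sum_(i < k) (i == Ordinal jk)%:R *: b i.
  rewrite (bigD1 (Ordinal jk))//= eqxx scale1r big1 ?addr0// => i /negbTE ->.
  by rewrite scale0r.
have w0 : dot w w != 0.
  apply/eqP => /L2_dot_eq0 /eqP; rewrite subr_eq0 => /eqP.
  rewrite bjE pE => /bcoef /(_ (Ordinal jk)); rewrite eqxx cp0//= => /eqP.
  by rewrite oner_eq0.
have we l : (l < j)%N -> dot w (e l) = 0.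
  move=> lj; rewrite L2_dotDl L2_dotNl /p.
  by rewrite (@orthonormal_coord j e (fun l => dot bj (e l)))// subrr.
pose nw := L2_norm w.
have nw2 : nw ^+ 2 = dot w w by rewrite /nw L2_normK.
have nw0 : nw != 0 by rewrite -sqrf_eq0 nw2.
pose e' i := if i == j then nw^-1 *: w else e i.
have e'E i : (i < j)%N -> e' i = e i by move=> ij; rewrite /e' ltn_eqF.
have e'j : e' j = nw^-1 *: w by rewrite /e' eqxx.
exists e'; split.
- move=> i l; rewrite !ltnS (leq_eqVlt i) (leq_eqVlt l) => /predU1P[->|ij] /predU1P[->|lj].
  + by rewrite e'j L2_dotZl L2_dotZr -nw2 eqxx expr2 mulKf// mulVf.
  + by rewrite e'j e'E// L2_dotZl we// mulr0 gtn_eqF.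
  + by rewrite e'j e'E// L2_dotZr L2_dotC we// mulr0 ltn_eqF.
  + by rewrite !e'E//; exact: oe.
- move=> l; rewrite ltnS leq_eqVlt => /predU1P[->|lj].
    exists (fun i => nw^-1 * ((i == Ordinal jk)%:R - cp i)); split.
      move=> i ji; rewrite cp0 ?(ltnW ji)// (_ : (i == _) = false) ?subr0 ?mulr0//.
      by apply/negbTE; rewrite -val_eqE/= gtn_eqF.
    rewrite e'j /w bjE pE -sumrB scaler_sumr; apply: eq_bigr => i _.
    by rewrite -scalerBl scalerA.
  have [c0 cE] := hC l lj; exists (C l); split; last by rewrite e'E.
  by move=> i ji; rewrite c0// ltnW.
- move=> i; rewrite ltnS leq_eqVlt => /predU1P[ij|ij].
    exists (fun l => if l == j then nw else dot bj (e l)).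
    rewrite big_ord_recr/= eqxx e'j scalerA mulfV// scale1r.
    rewrite (eq_bigr (fun l : 'I_j => dot bj (e l) *: e l)); last first.
      by move=> l _; rewrite e'E// ltn_eqF.
    rewrite -/p /w addrC subrK /bj; congr b; exact/val_inj.
  have [c ->] := be i ij; exists (fun l => if l == j then 0 else c l).
  rewrite big_ord_recr/= eqxx scale0r addr0; apply: eq_bigr => l _.
  by rewrite e'E// ltn_eqF.
Qed.

End onb.

(** * The invariant measure of the unit sphere *)

Section sphere.
Context (R : realType) (M : ptopologicalType) (P : probability (borel_type M) R).
Local Notation L2 := (LspaceType2 P).
Local Notation dot u v := (L2_dot P (u : L2) (v : L2)).
Variables (E : set L2) (n : nat) (e : nat -> L2).
Hypothesis linE : linear_subspace E.
Hypothesis Ee : forall i, (i < n.+1)%N -> E (e i).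
Hypothesis oe : L2_orthonormal n.+1 e.
Hypothesis Ecoord : forall u, E u -> u = \sum_(i < n.+1) dot u (e i) *: e i.
Variable sigma : probability (L2_borel P) R.
Hypothesis hsigma : sphere_measure E sigma.

Lemma dot_coord (u : L2) (x : nat -> R) :
  dot u (\sum_(i < n.+1) x i *: e i) = \sum_(i < n.+1) dot u (e i) * x i.
Proof.
rewrite L2_dotC L2_dot_suml; apply: eq_bigr => i _.
by rewrite L2_dotZl mulrC L2_dotC.
Qed.

Lemma subspace_comb (x : nat -> R) : E (\sum_(i < n.+1) x i *: e i).
Proof. by apply: linear_subspace_sum => // i; exact: Ee. Qed.

Lemma norm_comb (x : nat -> R) :
  L2_norm (\sum_(i < n.+1) x i *: e i) = Num.sqrt (\sum_(i < n.+1) x i ^+ 2).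
Proof.
rewrite L2_normE dot_coord; congr Num.sqrt; apply: eq_bigr => i _.
by rewrite (orthonormal_coord _ oe)// expr2.
Qed.

(** Parseval's identity characterises membership in E by measurable functions
    of u; this is how the unit sphere is seen to be measurable. *)
Lemma parseval_memP (u : L2) : E u <-> dot u u = \sum_(i < n.+1) dot u (e i) ^+ 2.
Proof.
pose p := \sum_(i < n.+1) dot u (e i) *: e i.
have up : dot u p = \sum_(i < n.+1) dot u (e i) ^+ 2.
  by rewrite (dot_coord _ (fun i => dot u (e i))); apply: eq_bigr => i _; rewrite expr2.
have pp : dot p p = \sum_(i < n.+1) dot u (e i) ^+ 2.
  rewrite [in X in L2_dot _ _ X]/p (dot_coord _ (fun i => dot u (e i))).
  apply: eq_bigr => i _.
  by rewrite (orthonormal_coord (fun i => dot u (e i)) oe)// expr2.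
split=> [Eu|h]; first by rewrite -up /p -Ecoord.
suff -> : u = p by exact: (subspace_comb (fun i => dot u (e i))).
apply/eqP; rewrite -subr_eq0; apply/eqP/L2_dot_eq0.
rewrite !(L2_dotDl, L2_dotDr, L2_dotNl, L2_dotNr) (L2_dotC p u) up pp h.
by rewrite subrr add0r opprK addNr.
Qed.

Lemma unit_sphereE : unit_sphere E =
  [set u : L2_borel P | (L2_norm (u : L2) == 1) && (\sum_(i < n.+1) dot u (e i) ^+ 2 == 1)].
Proof.
apply/seteqP; split => u /=.
  move=> [/parseval_memP h n1]; rewrite n1 eqxx/= -h -L2_normK n1 expr1n.
  exact: eqxx.
move=> /andP[/eqP n1 /eqP s1]; split => //.
by apply/parseval_memP; rewrite -L2_normK n1 s1 expr1n.
Qed.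

Lemma measurable_unit_sphere : measurable (unit_sphere E : set (L2_borel P)).
Proof.
have m1 : measurable_fun [set: L2_borel P] (fun u : L2_borel P => \sum_(i < n.+1) dot u (e i) ^+ 2).
  by apply: measurable_sum => i; apply: measurable_funX; exact: measurable_L2_dot.
have m2 := @measurable_L2_norm _ _ _ P.
rewrite unit_sphereE.
have : measurable_fun [set: L2_borel P] (fun u : L2_borel P =>
    (L2_norm (u : L2) == 1) && (\sum_(i < n.+1) dot u (e i) ^+ 2 == 1)).
  by apply: measurable_and; apply: measurable_fun_eqr.
by move=> /(_ measurableT [set true] I); rewrite setTI.
Qed.

Lemma sphere_ae : {ae sigma, forall u, unit_sphere E u}.
Proof.
exists (~` unit_sphere E); split => //.
  exact: measurableC measurable_unit_sphere.
by rewrite probability_setC ?hsigma.1 ?subee//; exact: measurable_unit_sphere.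
Qed.

(** The hypothesis on sigma concerns the part of the preimage in the sphere;
    the remaining part is null. *)
Lemma sphere_refl (v : L2) (F : L2_borel P -> \bar R) : E v ->
  measurable_fun [set: L2_borel P] F -> (forall u, (0 <= F u)%E) ->
  (\int[sigma]_u F (L2_refl v u) = \int[sigma]_u F u)%E.
Proof.
move=> Ev mF F0.
pose U : L2_borel P -> L2_borel P := L2_refl v.
have mU : measurable_fun setT U := measurable_L2_refl v.
have iU : linear_isometry E (L2_refl v).
  split.
  - move=> u Eu; rewrite /L2_refl addrC -scaleNr.
    by have := linE.2; apply.
  - by move=> c u w _ _; exact: L2_refl_linear.
  - by move=> u _; rewrite !L2_normE L2_refl_dot.
have mS := measurable_unit_sphere.
transitivity (\int[pushforward sigma U]_u F u)%E.
  by rewrite ge0_integral_pushforward//= preimage_setT.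
apply: eq_measure_integral => A mA _; rewrite /pushforward.
have mUA : measurable (U @^-1` A) by rewrite -[X in measurable X]setTI; exact: mU.
suff : sigma (U @^-1` A) = sigma A by [].
apply: etrans (hsigma.2 _ iU A mA).
rewrite (measureDI sigma mUA mS) setIC.
rewrite [X in (X + _)%E](_ : _ = 0%E) ?add0e//.
apply/eqP; rewrite -measure_le0.
apply: (@le_trans _ _ (sigma (~` (unit_sphere E : set (L2_borel P))))); last first.
  by rewrite probability_setC// hsigma.1 subee.
apply: le_measure; rewrite ?inE//; first exact: measurableD.
  exact: measurableC.
Qed.

(** The reflection that exchanges w and |w| e_0 preserves both sigma and the
    inner product. *)
Lemma sphere_dot_norm (w : L2) (f : R -> \bar R) : E w ->
  measurable_fun [set: R] f -> (forall x, (0 <= f x)%E) ->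
  (\int[sigma]_u f (dot u w) = \int[sigma]_u f (L2_norm w * dot u (e 0%N))%R)%E.
Proof.
move=> Ew mf f0.
pose w' : L2 := L2_norm w *: e 0%N.
pose v := w - w'.
have Ev : E v.
  rewrite /v /w' addrC -scaleNr; have := linE.2; apply => //; exact: Ee.
pose F (u : L2_borel P) := f (dot u w').
have mF : measurable_fun setT F.
  by apply: (measurableT_comp mf); exact: measurable_L2_dot.
transitivity (\int[sigma]_u F u)%E.
  rewrite -(sphere_refl Ev mF (fun u => f0 _)).
  apply: eq_integral => u _; rewrite /F; congr f.
  rewrite -(L2_refl_dot v u w) L2_refl_axis//.
  by rewrite oe.
by apply: eq_integral => u _; rewrite /F L2_dotZr.
Qed.

Lemma sphere_moment_comb (a : R) (x : nat -> R) : 0 < \sum_(i < n.+1) x i ^+ 2 ->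
  (\int[sigma]_u abs_pow a (\sum_(i < n.+1) dot u (e i) * x i)%R)%E =
  ((Num.sqrt (\sum_(i < n.+1) x i ^+ 2) `^ a)%:E *
   \int[sigma]_u abs_pow a (dot u (e 0%N)))%E.
Proof.
move=> x0.
under eq_integral do rewrite -dot_coord.
rewrite (sphere_dot_norm (subspace_comb x) (measurable_abs_pow a) (@abs_pow_ge0 R a)) norm_comb.
have s0 : 0 < Num.sqrt (\sum_(i < n.+1) x i ^+ 2) by rewrite sqrtr_gt0.
under eq_integral do rewrite abs_powM//.
rewrite ge0_integralZl//.
- by apply: (measurableT_comp (measurable_abs_pow a)); exact: measurable_L2_dot.
- by move=> u _; exact: abs_pow_ge0.
Qed.

Lemma sphere_moment_E (a : R) : -1 < a ->
  (\int[sigma]_u abs_pow a (dot u (e 0%N)))%E =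
  (Gamma ((a + 1) / 2) * Gamma ((n%:R + 1) / 2)
       / (Num.sqrt pi * Gamma ((a + n%:R + 1) / 2)))%:E.
Proof.
move=> a1.
apply: (sphere_moment_closed _ _ sigma n (fun i (u : L2_borel P) => dot u (e i))) => //.
- by move=> i; exact: measurable_L2_dot.
- by apply: integral_ge0 => u _; exact: abs_pow_ge0.
- have [N [mN N0 sN]] := sphere_ae; exists N; split => // u /= h; apply: sN => /= hu.
  by apply: h; move: hu; rewrite unit_sphereE /= => /andP[_ /eqP].
- move=> x x0; rewrite sphere_moment_comb// abs_pow_neq0 ?gtr0_norm ?gt_eqF ?sqrtr_gt0//.
Qed.

End sphere.

(** * Ergodicity of transitive actions of compact groups *)

(** Nothing is asked of mu, whereas the sets of full measure form a filter
    only when mu is a measure. *)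
Lemma ae_imply d (T : semiRingOfSetsType d) (R : realFieldType)
    (mu : set T -> \bar R) (A B : T -> Prop) :
  (forall x, A x -> B x) -> {ae mu, forall x, A x} -> {ae mu, forall x, B x}.
Proof.
move=> AB [N [mN N0 sN]]; exists N; split => // x /= nB; apply: sN => /= Ax.
by apply: nB; exact: AB.
Qed.

Lemma second_countable_seq (T : topologicalType) : @second_countable T ->
  exists b : nat -> set T, (forall n, open (b n)) /\
    forall x W, nbhs x W -> exists n, b n x /\ b n `<=` W.
Proof.
move=> [B cB [oB hB]]; have /countable_injP[f injf] := cB.
pose b n := if pselect (exists2 U, B U & f U = n) is left h then sval (cid2 h) else set0.
exists b; split=> [n|x W /hB [U [BU Ux] UW]].
  by rewrite /b; case: pselect => [h|_]; [case: cid2 => U /= /oB|exact: open0].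
exists (f U); rewrite /b; case: pselect => [h|[]]; last by exists U.
case: cid2 => V /= BV fVU; have -> : V = U by apply: injf => //; rewrite inE.
by split.
Qed.

Section ergodic.
Context (R : realType) (G : topGroupType) (M : ptopologicalType).
Variables (act : G -> M -> M) (P : probability (borel_type M) R).
Hypotheses (cM : compact [set: M]) (hM : hausdorff_space M)
  (sM : @second_countable M) (cG : compact [set: G]) (aM : is_action act)
  (cact : continuous (fun z : G * M => act z.1 z.2))
  (tact : transitive_action act) (iP : invariant_measure act P).

Local Notation MB := (borel_type M).
Local Open Scope ereal_scope.

Lemma measurable_open (U : set M) : open U -> measurable (U : set MB).
Proof. exact: sub_sigma_algebra. Qed.

Lemma measurable_closed (K : set M) : closed K -> measurable (K : set MB).
Proof. by move=> cK; rewrite -[K]setCK; apply: measurableC; apply: measurable_open; exact: closed_openC. Qed.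

Lemma measurable_open_prod (V : set (M * M)) : open V ->
  measurable (V : set (MB * MB)).
Proof.
move=> oV; have [b [ob hb]] := second_countable_seq sM.
pose F (ij : nat * nat) : set (MB * MB) :=
  if pselect (b ij.1 `*` b ij.2 `<=` V) then b ij.1 `*` b ij.2 else set0.
have -> : V = \bigcup_ij F ij.
  apply/seteqP; split=> [[x y] Vxy|z [[i j] _]]; last first.
    by rewrite /F; case: pselect => //= h /h.
  have [[W1 W2] /= [/hb [i [bi iW1]] /hb [j [bj jW2]]] WV] : nbhs (x, y) V.
    exact: open_nbhs_nbhs.
  exists (i, j) => //; rewrite /F; case: pselect => [_ //|[]].
  by move=> [u v] [/= /iW1 W1u /jW2 W2v]; exact: WV.
apply: countable_bigcupT_measurable => // ij.
rewrite /F; case: pselect => h /=; last exact: measurable0.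
by apply: measurableX; apply: measurable_open; exact: ob.
Qed.

Lemma act_continuous g : continuous (act g).
Proof.
move=> x; apply: (continuous_comp (f := fun y => (g, y)) (g := fun z : G * M => act z.1 z.2)); last exact: cact.
by apply: cvg_pair => /=; [exact: cvg_cst|exact: cvg_id].
Qed.

Lemma measurable_act g : measurable_fun [set: MB] (act g : MB -> MB).
Proof.
apply: (@measurability _ _ MB MB setT (act g) (@open M)) => [|_ [A oA <-]]; first by [].
rewrite setTI; apply: measurable_open; apply: open_comp => // x _.
exact: act_continuous.
Qed.

Lemma actK g : cancel (act g) (act g^-1%g).
Proof. by move=> x; rewrite -aM.2 mulVg aM.1. Qed.

Lemma actVK g : cancel (act g^-1%g) (act g).
Proof. by move=> x; rewrite -aM.2 mulgV aM.1. Qed.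

(** V consists of the pairs that no element of G brings to a position with one
    point in K and the other outside U. It is invariant by construction, and
    open by the tube lemma, because G is compact. *)
Lemma invariant_entourage (K U : set M) : closed K -> open U -> K `<=` U ->
  exists V : set (M * M), [/\ open V, forall x, V (x, x),
    forall x y, V (x, y) -> V (y, x),
    forall g x y, V (act g x, act g y) <-> V (x, y) &
    forall x y, K x -> V (x, y) -> U y].
Proof.
move=> cK oU KU.
(* ok x y fails when one of the points is in K and the other is outside U. *)
pose ok x y := (~ K x \/ U y) /\ (~ K y \/ U x).
exists [set z | forall g, ok (act g z.1) (act g z.2)]; split.
- have okop : open [set w : G * (M * M) | ok (act w.1 w.2.1) (act w.1 w.2.2)].
    have c1 : continuous (fun w : G * (M * M) => act w.1 w.2.1).
      move=> w; apply: (continuous_comp (f := fun w : G * (M * M) => (w.1, w.2.1))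
        (g := fun z : G * M => act z.1 z.2)); last exact: cact.
      by apply: cvg_pair => /=; [exact: cvg_fst|apply: (cvg_comp snd fst); [exact: cvg_snd|exact: cvg_fst]].
    have c2 : continuous (fun w : G * (M * M) => act w.1 w.2.2).
      move=> w; apply: (continuous_comp (f := fun w : G * (M * M) => (w.1, w.2.2))
        (g := fun z : G * M => act z.1 z.2)); last exact: cact.
      by apply: cvg_pair => /=; [exact: cvg_fst|apply: (cvg_comp snd snd); [exact: cvg_snd|exact: cvg_snd]].
    have oKC : open (~` K) by exact: closed_openC.
    rewrite (_ : [set _ | _] = 
      ((fun w : G * (M * M) => act w.1 w.2.1) @^-1` (~` K) `|`
       (fun w : G * (M * M) => act w.1 w.2.2) @^-1` U) `&`
      ((fun w : G * (M * M) => act w.1 w.2.2) @^-1` (~` K) `|`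
       (fun w : G * (M * M) => act w.1 w.2.1) @^-1` U))//.
    by apply: openI; apply: openU; apply: open_comp.
  rewrite openE => z Vz.
  have /compact_near_coveringP /(_ _ (nbhs z) (fun i g => ok (act g i.1) (act g i.2)) _) := cG.
  move=> /(_ _) /wrap[|h].
    move=> g _.
    exact: (open_nbhs_nbhs (conj okop (Vz g : [set w : G * (M * M) | ok (act w.1 w.2.1) (act w.1 w.2.2)] (g, z)))).
  by apply: filterS h => i h g; exact: h.
- by move=> x g /=; split; case: (pselect (K (act g x))) => [/KU|]; by [right|left].
- by move=> x y h g /=; have [] := h g.
- move=> g x y; split=> h k /=; last by rewrite -!aM.2; exact: h.
  by have := h (k * g^-1)%g; rewrite /= !aM.2 !actK.
- by move=> x y Kx /(_ 1%g) /=; rewrite !aM.1 => -[[//|]].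
Qed.

Lemma eq_measure_ae (B C : set MB) : measurable B -> measurable C ->
  {ae P, forall x, B x <-> C x} -> P B = P C.
Proof.
move=> mB mC BC.
rewrite -[B]setIT -[C]setIT -!integral_indic//.
apply: ge0_ae_eq_integral => //.
- by apply/measurable_EFinP; exact: measurable_indic.
- by apply/measurable_EFinP; exact: measurable_indic.
apply: filterS BC => x [h1 h2] _; congr (_%:E).
rewrite !indicE; congr (_ %:R); congr nat_of_bool.
by apply/idP/idP; rewrite !inE.
Qed.

Definition quasi_invariant (A : set MB) :=
  forall g, {ae P, forall x, A (act g x) <-> A x}.

Section entourage.
Variable V : set (M * M).
Hypotheses (oV : open V) (Vrefl : forall x, V (x, x))
  (Vsym : forall x y, V (x, y) -> V (y, x))
  (Vinv : forall g x y, V (act g x, act g y) <-> V (x, y)).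

Let Vs (x : M) : set MB := [set y | V (x, y)].

Lemma section_measure_inv (A : set MB) g x : measurable A -> quasi_invariant A ->
  measurable (Vs x) ->
  P (A `&` Vs (act g x)) = P (A `&` Vs x).
Proof.
move=> mA qA mV.
have VE : Vs (act g x) = act g^-1%g @^-1` Vs x.
  apply/seteqP; split => y /=; rewrite /Vs /=.
    by rewrite -{1}(actVK g y) => /Vinv.
  by move=> h; rewrite -(actVK g y); apply/Vinv.
have mact (B : set MB) : measurable B -> measurable (act g^-1%g @^-1` B : set MB).
  by move=> mB; rewrite -[X in measurable X]setTI; exact: measurable_act.
rewrite VE -(iP g^-1%g (measurableI _ _ mA mV)); apply: eq_measure_ae.
- by apply: measurableI => //; exact: mact.
- by apply: mact; exact: measurableI.
- have := qA g^-1%g; apply: ae_imply => y h.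
  by split => -[h1 h2]; split => //; apply/h.
Qed.

Lemma measurable_Vs x : measurable (Vs x).
Proof.
rewrite (_ : Vs x = xsection (V : set (MB * MB)) x); last first.
  by apply/seteqP; split => y; rewrite /xsection/= inE.
by apply: measurable_xsection; exact: measurable_open_prod.
Qed.

Lemma section_measure_const (A : set MB) x y : measurable A -> quasi_invariant A ->
  P (A `&` Vs x) = P (A `&` Vs y).
Proof.
move=> mA qA; have [g <-] := tact x y.
by rewrite section_measure_inv//; exact: measurable_Vs.
Qed.

(** Both sides measure the set of V-close pairs in B1 x B2, which is symmetric
    in its two factors. *)
Lemma section_fubini (B1 B2 : set MB) : measurable B1 -> measurable B2 ->
  \int[P]_x ((\1_B1 x)%:E * P (B2 `&` Vs x)) = \int[P]_x ((\1_B2 x)%:E * P (B1 `&` Vs x)).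
Proof.
move=> mB1 mB2.
pose W : set (MB * MB) := (B1 `*` B2) `&` V.
have mW : measurable W.
  by apply: measurableI; [exact: measurableX|exact: measurable_open_prod].
have := indic_fubini_tonelli P P mW.
rewrite indic_fubini_tonelli_FE// indic_fubini_tonelli_GE// => h.
have EX x : (\1_B1 x)%:E * P (B2 `&` Vs x) = P (xsection W x).
  rewrite indicE; have [B1x|B1x] := pselect (B1 x).
    rewrite mem_set// mul1e; congr (P _); apply/seteqP.
    by split=> y; rewrite /xsection/= inE => -[] // [].
  rewrite memNset// mul0e (_ : xsection W x = set0) ?measure0//.
  by apply/seteqP; split => // y; rewrite /xsection /= inE => -[[]].
have EY y : (\1_B2 y)%:E * P (B1 `&` Vs y) = P (ysection W y).
  rewrite indicE; have [B2y|B2y] := pselect (B2 y).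
    rewrite mem_set// mul1e; congr (P _); apply/seteqP.
    split=> x; rewrite /ysection/= inE.
      by move=> [? /Vsym].
    by move=> [[? _] /Vsym].
  rewrite memNset// mul0e (_ : ysection W y = set0) ?measure0//.
  by apply/seteqP; split => // x; rewrite /ysection /= inE => -[[]].
under eq_integral do rewrite EX.
by under [in RHS]eq_integral do rewrite EY.
Qed.

Lemma measurable_section_measure (B : set MB) : measurable B ->
  measurable_fun [set: MB] (fun x => P (B `&` Vs x)).
Proof.
move=> mB; have mW : measurable ((setT `*` B) `&` V : set (MB * MB)).
  by apply: measurableI; [exact: measurableX|exact: measurable_open_prod].
rewrite (_ : (fun _ => _) = P \o xsection ((setT `*` B) `&` V : set (MB * MB))).
  exact: measurable_fun_xsection.
apply/funext => x /=; congr (P _); apply/seteqP.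
by split=> y; rewrite /xsection/= inE => -[] // [].
Qed.

(** All sections have the same measure. If it were 0, every point would have a
    null neighbourhood, and countably many of these cover M. *)
Lemma section_measure_gt0 x : 0 < P (Vs x).
Proof.
rewrite lt0e measure_ge0 andbT; apply/negP => /eqP Vx0.
have V0 y : P (Vs y) = 0.
  have qT : quasi_invariant setT by move=> g; exact: nearW.
  by have := section_measure_const y x measurableT qT; rewrite !setTI Vx0.
have [b [ob hb]] := second_countable_seq sM.
pose F n : set MB := if P (b n) == 0 then b n else set0.
have : P [set: MB] = 0.
  have -> : [set: MB] = \bigcup_n F n.
    apply/seteqP; split => // y _.
    have [[W1 W2] /= [n1 n2] WV] : nbhs (y, y) V by exact: open_nbhs_nbhs.
    have [n [bn nW]] := hb y _ (filterI n1 n2).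
    exists n => //; rewrite /F ifT//; apply/eqP.
    apply/eqP; rewrite -measure_le0 -(V0 y); apply: le_measure; rewrite ?inE.
    - exact: measurable_open.
    - exact: measurable_Vs.
    - by move=> z /nW [_ W2z]; apply: WV; split => //=; exact: (nW _ bn).1.
  have mF n : measurable (F n).
    by rewrite /F; case: ifPn => _; [exact: measurable_open|exact: measurable0].
  apply/negligibleP; first exact: bigcupT_measurable.
  apply: negligible_bigcup => n; apply/negligibleP; first exact: mF.
  by rewrite /F; case: ifPn => [/eqP|]; rewrite ?measure0.
by rewrite probability_setT => /eqP; rewrite onee_eq0.
Qed.

(** Let c be the common measure of the sections of V. The points of the
    intersection of A and K have their whole section in U, so the V-close
    pairs in A x U have measure at least c P(A /\ K). Counted from U they have
    measure P(U) times the common measure of the sections within A, which is c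
    P(A). *)
Lemma section_measure_le (A : set MB) (K U : set M) : measurable A -> quasi_invariant A ->
  closed K -> open U -> (forall x y, K x -> V (x, y) -> U y) ->
  P (A `&` K) <= P A * P U.
Proof.
move=> mA qA cK oU KU.
have mK := measurable_closed cK; have mU := measurable_open oU.
pose c := P (Vs point).
have c0 : 0 < c by exact: section_measure_gt0.
have cfin : c \is a fin_num by rewrite fin_num_measure//; exact: measurable_Vs.
have qT : quasi_invariant setT by move=> g; exact: nearW.
have cE x : P (Vs x) = c.
  by have := section_measure_const x point measurableT qT; rewrite !setTI.
pose c' := P (A `&` Vs point).
have c'E x : P (A `&` Vs x) = c' by exact: section_measure_const.
have h1 : c' = c * P A.
  have := section_fubini measurableT mA.
  under eq_integral do rewrite c'E indicT mul1e.
  under [in X in _ = X -> _]eq_integral do rewrite setTI cE.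
  have -> : \int[P]_x c' = c'.
    by rewrite -[RHS]mule1 -(probability_setT P); apply: integral_cst.
  move=> ->.
  rewrite ge0_integralZr//; last by rewrite ltW.
  - by rewrite integral_indic// setIT muleC.
  - by apply/measurable_EFinP; exact: measurable_indic.
have h2 := section_fubini mU mA.
have mAK : measurable (A `&` K) by exact: measurableI.
have m1 (B : set MB) : measurable B -> measurable_fun [set: MB] (fun x => (\1_B x)%:E : \bar R).
  by move=> mB; apply/measurable_EFinP; exact: measurable_indic.
have : \int[P]_x ((\1_(A `&` K) x)%:E * c) <= \int[P]_x ((\1_A x)%:E * P (U `&` Vs x)).
  apply: ge0_le_integral => //.
  - by move=> x _; rewrite mule_ge0 ?(ltW c0)// lee_fin.
  - by apply: emeasurable_funM => //; exact: m1.
  - apply: emeasurable_funM; first exact: m1.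
    exact: measurable_section_measure.
  - move=> x _; rewrite !indicE; have [[Ax Kx]|nAK] := pselect ((A `&` K) x).
      rewrite !mem_set// !mul1e (_ : U `&` Vs x = Vs x) ?cE//.
      by apply/seteqP; split => y; [case|move=> h; split => //; exact: KU h].
    by rewrite memNset// mul0e mule_ge0.
rewrite -h2.
under [in X in _ <= X -> _]eq_integral do rewrite c'E.
rewrite ge0_integralZr ?(ltW c0)//; last exact: m1.
have c'0 : 0 <= c' by exact: measure_ge0.
rewrite ge0_integralZr//; last exact: m1.
rewrite !integral_indic// !setIT h1 muleCA [X in X <= _]muleC [P U * _]muleC.
by rewrite lee_pmul2l.
Qed.

End entourage.

Lemma quasi_invariantC (A : set MB) : quasi_invariant A -> quasi_invariant (~` A).
Proof.
by move=> qA g; have := qA g; apply: ae_imply => x h /=; split; apply: contra_not => /h.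
Qed.

(** U is the increasing union of closed sets, because a compact Hausdorff
    space is regular. *)
Lemma quasi_invariant_open_le (A : set MB) (U : set M) : measurable A ->
  quasi_invariant A -> open U -> P (A `&` U) <= P A * P U.
Proof.
move=> mA qA oU; have [b [ob hb]] := second_countable_seq sM.
pose k n := if pselect (closure (b n) `<=` U) then closure (b n) else set0.
pose K n := \big[setU/set0]_(i < n) k i.
have ck n : closed (k n).
  by rewrite /k; case: pselect => h /=; [exact: closed_closure|exact: closed0].
have cK n : closed (K n) by apply: closed_bigsetU => i _; exact: ck.
have kU n : k n `<=` U by rewrite /k; case: pselect => [h|_] /=; [exact: h|exact: sub0set].
have KU n : K n `<=` U.
  by rewrite /K; elim/big_ind: _ => // B C BU CU x [/BU|/CU].
have UE : A `&` U = \bigcup_n (A `&` K n).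
  apply/seteqP; split=> [y [Ay Uy]|y [n _ [Ay /KU Uy]]//].
  have nU : nbhs y U by exact: open_nbhs_nbhs.
  have [W nW WU] := compact_regular hM cM filterT nU.
  have [n [bn nbW]] := hb y W nW.
  exists n.+1 => //; split => //; rewrite /K big_ord_recr /=; right.
  rewrite /k; case: pselect => [_|[]] /=; first exact: subset_closure.
  by apply: subset_trans WU; exact: closure_subset.
have mK n : measurable (A `&` K n).
  by apply: measurableI => //; exact: measurable_closed.
have : P (A `&` K n) @[n --> \oo] --> P (A `&` U).
  rewrite UE; apply: nondecreasing_cvg_mu => //; first exact: bigcupT_measurable.
  apply/nondecreasing_seqP => n; apply/subsetPset; apply: setIS.
  by rewrite /K big_ord_recr /=; left.
move=> h; rewrite -(cvg_lim _ h)//; apply: lime_le; first by apply/cvg_ex; exists (P (A `&` U)).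
apply: nearW => n.
have [V [oV Vr Vs Vi VU]] := invariant_entourage (cK n) oU (KU n).
exact: (section_measure_le oV Vr Vs Vi mA qA (cK n) oU VU).
Qed.

(** The other inequality is the same one for the complement of A. *)
Lemma quasi_invariant_open (A : set MB) (U : set M) : measurable A ->
  quasi_invariant A -> open U -> P (A `&` U) = P A * P U.
Proof.
move=> mA qA oU; apply/eqP; rewrite eq_le quasi_invariant_open_le//=.
have mU := measurable_open oU.
have := quasi_invariant_open_le (measurableC mA) (quasi_invariantC qA) oU.
have -> : P U = P (A `&` U) + P (~` A `&` U).
  rewrite {1}(_ : P U = P (U `\` A) + P (U `&` A)); last exact: measureDI.
  by rewrite addeC setDE ![U `&` _]setIC.
rewrite probability_setC//.
have fP (B : set MB) : measurable B -> P B = (fine (P B))%:E.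
  by move=> mB; rewrite fineK// fin_num_measure.
rewrite (fP _ mA) (fP _ (measurableI _ _ mA mU)) (fP _ (measurableI _ _ (measurableC mA) mU)).
move: (fine _) (fine _) (fine _) => x y z.
by rewrite -!EFinD -!EFinM !lee_fin => h; lra.
Qed.

(** Open sets generate the Borel sets and are stable under intersection, so A
    is independent of every Borel set, and in particular of itself. *)
Lemma quasi_invariant01 (A : set MB) : measurable A -> quasi_invariant A ->
  P A = 0 \/ P A = 1.
Proof.
move=> mA qA.
have pA0 : (0 <= fine (P A))%R by apply: fine_ge0.
pose m2 : {measure set MB -> \bar R} := mscale (NngNum pA0) P.
pose m1 : {measure set MB -> \bar R} := mrestr P mA.
have pAE : (fine (P A))%:E = P A by rewrite fineK// fin_num_measure.
have : m1 A = m2 A.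
  apply: (@measure_unique _ R MB (@open M) (fun=> setT)) => //.
  - by move=> B C oB oC; exact: openI.
  - by move=> _; exact: openT.
  - by apply/seteqP; split => // x _; exists 0%N.
  - move=> U oU; suff : P (U `&` A) = (fine (P A))%:E * P U by [].
    by rewrite pAE setIC; exact: quasi_invariant_open.
  - move=> _; suff : P (setT `&` A) < +oo by [].
    by rewrite setTI -pAE ltry.
move=> h; have {h} : P (A `&` A) = (fine (P A))%:E * P A by [].
rewrite setIid.
move: (fine (P A)) pAE => p <-; rewrite -EFinM => /(congr1 fine) /= /eqP.
rewrite -subr_eq0 -{1}(mulr1 p) -mulrBr mulf_eq0 subr_eq0 => /orP[/eqP->|/eqP<-]; first by left.
by right.
Qed.

(** Each of the sets where f exceeds its mean c and where f is below c is null
    or full. A full one would give f - c a constant sign, and its mean 0 would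
    then force f = c. *)
Lemma invariant_const (f : M -> R) : measurable_fun [set: MB] f ->
  P.-integrable [set: MB] (EFin \o f) ->
  (forall g, {ae P, forall x, f (act g x) = f x}) ->
  {ae P, forall x, f x = fine (\int[P]_x (f x)%:E)}.
Proof.
move=> mf If invf; set c := fine _.
have mA : measurable [set x : MB | (c < f x)%R].
  rewrite -[X in measurable X]setTI.
  by have := mf measurableT `]c, +oo[%classic (measurable_itv _); rewrite /preimage/=; under eq_set do rewrite in_itv/= andbT.
have mB : measurable [set x : MB | (f x < c)%R].
  rewrite -[X in measurable X]setTI.
  by have := mf measurableT `]-oo, c[%classic (measurable_itv _); rewrite /preimage/=; under eq_set do rewrite in_itv/=.
have qA : quasi_invariant [set x : MB | (c < f x)%R].
  by move=> g; have := invf g; apply: ae_imply => x /= ->.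
have qB : quasi_invariant [set x : MB | (f x < c)%R].
  by move=> g; have := invf g; apply: ae_imply => x /= ->.
have cE : c%:E = \int[P]_x (f x)%:E.
  by rewrite fineK//; exact: integrable_fin_num If.
pose D x := (f x - c)%:E.
have mD : measurable_fun [set: MB] D.
  by apply/measurable_EFinP; exact: measurable_funB.
have D0 : \int[P]_x D x = 0.
  have Ic : P.-integrable [set: MB] (cst c%:E) by exact: finite_measure_integrable_cst.
  transitivity (\int[P]_x ((EFin \o f) x - cst c%:E x)); first by [].
  rewrite integralB// -cE (_ : \int[P]_x cst c%:E x = c%:E) ?subee//.
  by rewrite -[RHS]mule1 -(probability_setT P); apply: integral_cst.
have abs0 : \int[P]_x `|D x| = 0 -> {ae P, forall x, f x = c}.
  move/(ae_eq_integral_abs P measurableT mD); apply: ae_imply => x /(_ I) [].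
  by move=> /eqP; rewrite subr_eq0 => /eqP.
have P1 (B : set MB) : measurable B -> P B = 1 -> {ae P, forall x, B x}.
  move=> mB' PB; exists (~` B); split => //; first exact: measurableC.
  by rewrite probability_setC// PB subee.
have mabs : measurable_fun [set: MB] (fun x => `|D x|) by exact: measurableT_comp.
have [A0|A1] := quasi_invariant01 mA qA; last first.
  apply: abs0; rewrite -D0; apply: ae_eq_integral => //.
  have := P1 _ mA A1; apply: ae_imply => x cf _.
  by rewrite gee0_abs// lee_fin subr_ge0; exact: ltW cf.
have [B0|B1] := quasi_invariant01 mB qB; last first.
  have iD : P.-integrable [set: MB] D.
    rewrite (_ : D = (EFin \o f) \- cst c%:E)//; apply: integrableB => //.
    exact: finite_measure_integrable_cst.
  apply: abs0; transitivity (\int[P]_x ((-1)%:E * D x)).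
    apply: ae_eq_integral => //; first exact: measurable_funeM.
    have := P1 _ mB B1; apply: ae_imply => x cf _.
    by rewrite mulN1e lee0_abs// lee_fin subr_le0; exact: ltW cf.
  by rewrite integralZl// D0 mule0.
exists ([set x : MB | (c < f x)%R] `|` [set x : MB | (f x < c)%R]); split.
- exact: measurableU.
- apply/eqP; rewrite -measure_le0; apply: le_trans (measureU2 _ mA mB) _.
  by rewrite [X in X + _](A0 : _ = 0) [X in _ + X](B0 : _ = 0) adde0.
- move=> x /= /eqP; rewrite neq_lt => /orP[?|?]; [by right|by left].
Qed.

End ergodic.

(** * The squared norm of the evaluation at a point *)

Lemma L2_sumE d (T : measurableType d) (R : realType) (mu : {measure set T -> \bar R})
    (c : nat -> R) (e : nat -> LspaceType2 mu) (k : nat) :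
  {ae mu, forall x, (\sum_(i < k) c i *: e i : LspaceType2 mu) x = \sum_(i < k) c i * e i x}.
Proof.
elim: k => [|k IH].
  have := L2_zeroE mu; apply: ae_imply => x h.
  by rewrite !big_ord0.
rewrite big_ord_recr /=.
have h1 := L2_addE (\sum_(i < k) c i *: e i) (c k *: e k).
apply: filterS3 h1 IH (L2_scaleE (c k) (e k)) => x h1 h2 h3.
by rewrite big_ord_recr /= -h2 -h3 -h1.
Qed.

Lemma ae_forall_lt d (T : measurableType d) (R : realType) (mu : {measure set T -> \bar R})
    (A : nat -> T -> Prop) (k : nat) :
  (forall i, (i < k)%N -> {ae mu, forall x, A i x}) ->
  {ae mu, forall x, forall i, (i < k)%N -> A i x}.
Proof.
elim: k => [_|k IH hA]; first exact: (aeW mu).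
apply: filterS2 (IH (fun i ik => hA i (ltnW ik))) (hA k (ltnSn k)) => x h1 h2 i.
by rewrite ltnS leq_eqVlt => /predU1P[->//|]; exact: h1.
Qed.

Section kernel_const.
Context (R : realType) (G : topGroupType) (M : ptopologicalType).
Variables (act : G -> M -> M) (P : probability (borel_type M) R).
Hypotheses (mact : forall g, measurable_fun [set: borel_type M] (act g : borel_type M -> borel_type M))
  (iP : invariant_measure act P).
Local Notation L2 := (LspaceType2 P).
Local Notation MB := (borel_type M).
Local Notation dot u v := (L2_dot P (u : L2) (v : L2)).
Local Open Scope ereal_scope.

Lemma integral_act g (f : MB -> \bar R) : measurable_fun [set: MB] f ->
  \int[P]_x f (act g x) = \int[P]_x f x.
Proof.
move=> mf.
have ge0 (h : MB -> \bar R) : measurable_fun [set: MB] h -> (forall x, 0 <= h x) ->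
    \int[P]_x h (act g x) = \int[P]_x h x.
  move=> mh h0; transitivity (\int[pushforward P (act g : MB -> MB)]_x h x).
    by rewrite ge0_integral_pushforward//= ?preimage_setT.
  by apply: eq_measure_integral => A mA _; exact: (iP g mA).
rewrite integralE [RHS]integralE; congr (_ - _).
- under eq_integral do rewrite funeposE.
  by rewrite -(ge0 _ (measurable_funepos mf) (funepos_ge0 f)); apply: eq_integral => x _; rewrite funeposE.
- under eq_integral do rewrite funenegE.
  by rewrite -(ge0 _ (measurable_funeneg mf) (funeneg_ge0 f)); apply: eq_integral => x _; rewrite funenegE.
Qed.

Variables (E : set L2) (n : nat) (e : nat -> L2).
Hypotheses (hE : condition_E act E)
  (Ee : forall i, (i < n.+1)%N -> E (e i)) (oe : L2_orthonormal n.+1 e)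
  (Ecoord : forall u, E u -> u = (\sum_(i < n.+1) dot u (e i) *: e i)%R).

(** The diagonal of the reproducing kernel of E. *)
Definition kernel_diag (x : MB) : R := (\sum_(i < n.+1) e i x ^+ 2)%R.

(** The translates v_i of the basis are again an orthonormal family of E, so
    they are related to the basis by an orthogonal matrix Q, which preserves
    the sum of the squares. *)
Lemma kernel_diag_invariant g : {ae P, forall x, kernel_diag (act g x) = kernel_diag x}.
Proof.
have [v hv] : {v : nat -> L2 & forall i, (i < n.+1)%N -> E (v i) /\ {ae P, forall x, v i x = e i (act g x)}}.
  apply: (@choice _ _ (fun i w => (i < n.+1)%N -> E w /\ {ae P, forall x, (w : L2) x = e i (act g x)})) => i.
  case: (ltnP i n.+1) => [/Ee ei|_]; last by exists 0%R.
  by have [w Ew hw] := E_invariant hE g ei; exists w.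
have dv i j : (i < n.+1)%N -> (j < n.+1)%N -> dot (v i) (v j) = dot (e i) (e j).
  move=> ni nj; have [Ei vi] := hv i ni; have [Ej vj] := hv j nj.
  apply/EFin_inj; rewrite -!L2_dot_fin.
  have m (u w : L2) : measurable_fun [set: MB] (fun x => (u x * w x)%:E).
    by apply/measurable_EFinP; apply: measurable_funM; exact: measurable_L2.
  rewrite -[RHS](integral_act g (m (e i) (e j))).
  apply: ae_eq_integral => //; first exact: (measurableT_comp (m (e i) (e j)) (mact g)).
  by apply: filterS2 vi vj => x -> -> _.
pose Q : 'M[R]_n.+1 := \matrix_(i, j) dot (v i) (e j).
have QQ : (Q *m Q^T = 1%:M)%R.
  apply/matrixP => i k; rewrite !mxE.
  transitivity (dot (v i) (v k)); last first.
    by rewrite dv// oe// -val_eqE.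
  have [Ek _] := hv k (ltn_ord k).
  rewrite (Ecoord Ek) (dot_coord n e (v i) (fun j => dot (v k) (e j))).
  by apply: eq_bigr => j _; rewrite !mxE.
have QQ' := mulmx1C QQ.
have vE : {ae P, forall x, forall i : 'I_n.+1, v i x = (\sum_(j < n.+1) Q i j * e j x)%R}.
  have h i : (i < n.+1)%N ->
      {ae P, forall x, v i x = (\sum_(j < n.+1) dot (v i) (e j) * e j x)%R}.
    move=> ni; have [Ei _] := hv i ni.
    have := L2_sumE (fun j => dot (v i) (e j)) e n.+1.
    by rewrite -(Ecoord Ei).
  have := ae_forall_lt h; apply: ae_imply => x hx i.
  by rewrite hx//; apply: eq_bigr => j _; rewrite !mxE.
have vg : {ae P, forall x, forall i : 'I_n.+1, v i x = e i (act g x)}.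
  have h i (ni : (i < n.+1)%N) := (hv i ni).2.
  by have := ae_forall_lt h; apply: ae_imply => x hx i; exact: hx.
apply: filterS2 vE vg => x h1 h2; rewrite /kernel_diag.
pose c : 'cV[R]_n.+1 := \col_j e j x.
transitivity (((Q *m c)^T *m (Q *m c)) 0 0)%R.
  rewrite !mxE; apply: eq_bigr => i _; rewrite !mxE -h2 h1 expr2.
  by congr (_ * _)%R; apply: eq_bigr => j _; rewrite !mxE.
rewrite trmx_mul mulmxA -(mulmxA _ Q^T) QQ' mulmx1 !mxE.
by apply: eq_bigr => i _; rewrite !mxE expr2.
Qed.

Lemma integral_kernel_diag : \int[P]_x (kernel_diag x)%:E = n.+1%:R%:E.
Proof.
under eq_integral do rewrite /kernel_diag -sumEFin.
rewrite ge0_integral_sum//; last 2 first.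
- move=> i; apply/measurable_EFinP; apply: measurable_funX; exact: measurable_L2.
- by move=> i x _; rewrite lee_fin sqr_ge0.
rewrite (eq_bigr (fun=> 1)) => [|i _].
  by rewrite sumEFin; congr (_%:E); rewrite sumr_const card_ord.
under eq_integral do rewrite expr2.
by rewrite L2_dot_fin oe// eqxx.
Qed.

Lemma measurable_kernel_diag : measurable_fun [set: MB] kernel_diag.
Proof. by apply: measurable_sum => i; apply: measurable_funX; exact: measurable_L2. Qed.

Lemma integrable_kernel_diag : P.-integrable [set: MB] (EFin \o kernel_diag).
Proof.
apply/integrableP; split; first by apply/measurable_EFinP; exact: measurable_kernel_diag.
under eq_integral => x _.
  rewrite gee0_abs; last by rewrite lee_fin; apply: sumr_ge0 => i _; exact: sqr_ge0.
  over.
by rewrite /= integral_kernel_diag ltry.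
Qed.

End kernel_const.

(** * The mean value *)

Section mean.
Context (R : realType) (M : ptopologicalType) (P : probability (borel_type M) R).
Local Notation L2 := (LspaceType2 P).
Local Notation MB := (borel_type M).
Local Notation SB := (L2_borel P).
Local Notation dot u v := (L2_dot P (u : L2) (v : L2)).
Variables (E : set L2) (n : nat) (e : nat -> L2).
Hypotheses (linE : linear_subspace E)
  (Ee : forall i, (i < n.+1)%N -> E (e i)) (oe : L2_orthonormal n.+1 e)
  (Ecoord : forall u, E u -> u = \sum_(i < n.+1) dot u (e i) *: e i).
Variables (sigma : probability SB R) (hsigma : sphere_measure E sigma).
Hypothesis kernelE : {ae P, forall x, kernel_diag n e x = n.+1%:R}.
Variables (a : R) (a1 : -1 < a).

Local Open Scope ereal_scope.

(** The values of the chosen representatives need not be jointly measurable in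
    u and p; evaluation through the basis is, and agrees with them almost
    everywhere for each u in E. *)
Definition eval_pow (z : SB * MB) : \bar R :=
  abs_pow a (\sum_(i < n.+1) dot z.1 (e i) * e i z.2)%R.

Lemma measurable_eval_pow : measurable_fun [set: SB * MB] eval_pow.
Proof.
apply: (measurableT_comp (measurable_abs_pow a)).
apply: measurable_sum => i; apply: measurable_funM.
  exact: (measurableT_comp (measurable_L2_dot (e i)) measurable_fst).
exact: (measurableT_comp (measurable_L2 (e i)) measurable_snd).
Qed.

Lemma eval_pow_ge0 z : 0 <= eval_pow z.
Proof. exact: abs_pow_ge0. Qed.

Lemma integral_abs_pow_L2 (u : L2) : E u ->
  \int[P]_p abs_pow a (u p) = \int[P]_x eval_pow (u, x).
Proof.
move=> Eu; apply: ge0_ae_eq_integral => //.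
- exact: (measurableT_comp (measurable_abs_pow a) (measurable_L2 u)).
- exact: (measurableT_comp measurable_eval_pow (pair1_measurable (u : SB))).
- by move=> x _; exact: abs_pow_ge0.
- by move=> x _; exact: eval_pow_ge0.
have := L2_sumE (fun i => dot u (e i)) e n.+1.
rewrite -(Ecoord Eu); apply: ae_imply => x h _.
by rewrite /eval_pow /= -h.
Qed.

(** Evaluation at x is the inner product with a vector of squared norm
    kernel_diag n e x. *)
Lemma integral_eval_pow x : kernel_diag n e x = n.+1%:R ->
  \int[sigma]_u eval_pow (u, x) =
  ((n.+1%:R `^ (a / 2))%R)%:E * \int[sigma]_u abs_pow a (dot u (e 0%N)).
Proof.
move=> hx; rewrite -hx /eval_pow /=.
rewrite (sphere_moment_comb linE Ee oe Ecoord hsigma a (x := fun i => e i x)); last first.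
  by rewrite -/(kernel_diag n e x) hx ltr0n.
by rewrite -/(kernel_diag n e x) -powR12_sqrt ?hx ?ler0n// -powRrM mulrC.
Qed.

Let I := (Gamma ((a + 1) / 2) * Gamma ((n%:R + 1) / 2) * (n%:R + 1) `^ (a / 2)
       / (Num.sqrt pi * Gamma ((a + n%:R + 1) / 2)))%R.

Lemma integral_eval_pow2 : \int[sigma]_u \int[P]_x eval_pow (u, x) = I%:E.
Proof.
rewrite (@fubini_tonelli _ _ _ _ _ sigma P _ measurable_eval_pow eval_pow_ge0).
transitivity (\int[P]_x I%:E).
  apply: ge0_ae_eq_integral => //.
  - exact: (@measurable_fun_fubini_tonelli_G _ _ _ _ _ sigma _ measurable_eval_pow eval_pow_ge0).
  - by move=> x _; apply: integral_ge0 => u _; exact: eval_pow_ge0.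
  - move=> x _; rewrite lee_fin /I !mulr_ge0 ?powR_ge0 ?invr_ge0 ?mulr_ge0 ?sqrtr_ge0//;
    by apply/ltW/Gamma_gt0; move: a1 (ler0n R n) => ? ?; lra.
  move: kernelE; apply: ae_imply => x hx _.
  rewrite (integral_eval_pow hx) (sphere_moment_E linE Ee oe Ecoord hsigma a1) -EFinM.
  congr (_%:E); rewrite -natr1 /I.
  by rewrite mulrA (mulrC (_ `^ _)%R).
by rewrite -[RHS]mule1 -(probability_setT P); apply: integral_cst.
Qed.

Lemma measurable_integral_eval_pow : measurable_fun [set: SB] (fun u => \int[P]_x eval_pow (u, x)).
Proof. exact: (@measurable_fun_fubini_tonelli_F _ _ _ _ _ P _ measurable_eval_pow eval_pow_ge0). Qed.

Let mS := measurable_unit_sphere linE Ee oe Ecoord.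

Lemma integral_sphere_full (f : SB -> \bar R) : measurable_fun [set: SB] f -> (forall u, 0 <= f u) ->
  \int[sigma]_(u in unit_sphere E) f u = \int[sigma]_u f u.
Proof.
move=> mf f0; rewrite integral_mkcond; apply: ge0_ae_eq_integral => //.
- by apply/(measurable_restrictT _ _).1 => //; exact: measurable_funS mf.
- by move=> u _; apply: erestrict_ge0.
have := sphere_ae linE Ee oe Ecoord hsigma; apply: ae_imply => u Su _.
by rewrite patchE mem_set.
Qed.

Lemma mean_abs_pow :
  \int[sigma]_(u in unit_sphere E) \int[P]_p abs_pow a (u p) = I%:E.
Proof.
rewrite -integral_eval_pow2 -(integral_sphere_full measurable_integral_eval_pow); last first.
  by move=> u; apply: integral_ge0 => x _; exact: eval_pow_ge0.
by apply: eq_integral => u; rewrite inE => -[Eu _]; exact: integral_abs_pow_L2.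
Qed.

Lemma integrable_mean_abs_pow :
  sigma.-integrable (unit_sphere E : set SB) (fun u : SB => \int[P]_p abs_pow a ((u : L2) p)).
Proof.
apply/integrableP; split.
  apply: (eq_measurable_fun (fun u : SB => \int[P]_x eval_pow (u, x))).
    by move=> u; rewrite inE => -[Eu _]; rewrite integral_abs_pow_L2.
  exact: measurable_funS measurable_integral_eval_pow.
under eq_integral => u _.
  rewrite gee0_abs; last by apply: integral_ge0 => x _; exact: abs_pow_ge0.
  over.
by rewrite mean_abs_pow ltry.
Qed.

Lemma ae_integrable_abs_pow :
  {ae sigma, forall u, unit_sphere E u -> P.-integrable [set: MB] (fun p => abs_pow a ((u : L2) p))}.
Proof.
have := integrable_ae mS integrable_mean_abs_pow.
apply: ae_imply => u h Su; apply/integrableP; split.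
  exact: (measurableT_comp (measurable_abs_pow a) (measurable_L2 (u : L2))).
under eq_integral do rewrite gee0_abs ?abs_pow_ge0//.
by rewrite ltey_eq h.
Qed.

End mean.

Unset Implicit Arguments.
Set Strict Implicit.
Set Printing Implicit Defensive.

Theorem theorem3 (R : realType) (m n : nat)
  (G : topGroupType) (sG : lie_group R m G)
  (M : ptopologicalType) (sM : smooth_manifold R n M) (g : riemannian_metric sM)
  (act : G -> M -> M) (o : M)
  (hM : homogeneous_irreducible sG g act o)
  (P : probability (borel_type M) R) (hP : invariant_measure act P)
  (E : set (LspaceType2 P)) (hE : condition_E act E)
  (d : nat) (hd : has_dim E d.+1)
  (sigma : probability (L2_borel P) R) (hsigma : sphere_measure E sigma)
  (a : R) (ha : -1 < a) :
  let S := unit_sphere E in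
  let J (u : LspaceType2 P) := (\int[P]_p abs_pow a (u p))%E in
  let mean := (\int[sigma]_(u in S) J u)%E in
  let bound := 2 `^ (a / 2) * (Gamma ((a + 1) / 2) / Num.sqrt pi) in
  [/\ {ae sigma, forall u, S u ->
         P.-integrable [set: M] (fun p => abs_pow a (u p))},
      sigma.-integrable S J /\
      mean = (Gamma ((a + 1) / 2) * Gamma ((d%:R + 1) / 2)
                * (d%:R + 1) `^ (a / 2)
              / (Num.sqrt pi * Gamma ((a + d%:R + 1) / 2)))%:E,
      (2 < a \/ -1 < a < 0 -> (mean < bound%:E)%E),
      (0 < a < 2 -> (bound%:E < mean)%E)
    & (a = 0 \/ a = 2 -> mean = bound%:E)].
Proof.
have [e [Ee oe Ecoord]] := exists_orthonormal_basis (E_subspace hE) hd.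
have cact := (act_smooth hM).1.
have kernelE : {ae P, forall x, kernel_diag d e x = d.+1%:R}.
  have := invariant_const (M_compact hM) (manifold_hausdorff sM)
    (manifold_second_countable sM) (G_compact hM) (act_action hM) cact
    (act_transitive hM) hP (measurable_kernel_diag d e) (integrable_kernel_diag oe)
    (kernel_diag_invariant (measurable_act cact) hP hE Ee oe Ecoord).
  by apply: ae_imply => x ->; rewrite integral_kernel_diag.
move=> S J mean bound.
have linE := E_subspace hE.
have meanE := mean_abs_pow linE Ee oe Ecoord hsigma kernelE ha.
have y0 : 0 < d%:R + 1 :> R by rewrite natr1 ltr0n.
have factor := mean_value_factor a d%:R (Gamma ((a + 1) / 2)) (Num.sqrt pi) y0.
have x0 : 0 < (d%:R + 1) / 2 :> R by rewrite divr_gt0.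
have xs0 : 0 < (d%:R + 1) / 2 + a / 2.
  by rewrite -mulrDl divr_gt0//; move: ha (ler0n R d) => ? ?; lra.
have b0 : 0 < bound.
  rewrite /bound !mulr_gt0 ?powR_gt0 ?invr_gt0 ?sqrtr_gt0 ?pi_gt0//.
  by apply: Gamma_gt0; rewrite divr_gt0//; move: ha => ?; lra.
have Gx0 := Gamma_gt0 _ xs0.
split.
- exact: (ae_integrable_abs_pow linE Ee oe Ecoord hsigma kernelE ha).
- split; last exact: meanE.
  exact: (integrable_mean_abs_pow linE Ee oe Ecoord hsigma kernelE ha).
- move=> h; rewrite /mean meanE lte_fin factor -/bound gtr_pMr// ltr_pdivrMr// mul1r.
  apply: Gamma_gt => //; move: h => [h|/andP[_ h]]; [left|right]; clear -h; lra.
- move=> h; rewrite /mean meanE lte_fin factor -/bound ltr_pMr// ltr_pdivlMr// mul1r.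
  apply: Gamma_lt => //; clear -h; lra.
- move=> h; rewrite /mean meanE factor -/bound; congr (_%:E).
  case: h Gx0 => ->; first by rewrite mul0r addr0 powRr0 mul1r => h; rewrite divff ?gt_eqF// mulr1.
  by rewrite divff// powRr1 ?(ltW x0)// GammaS// => h; rewrite divff ?gt_eqF// mulr1.
Qed.
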